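(* Let $G_1$ be a finite connected oriented graph with distinguished vertices $a_1,b_1$ such that $d_1(a_1,b_1)>1$ and there exist at least two edge-disjoint paths connecting $a_1$ to $b_1$ in $G_1$. Let $\bar G_\infty=(G_\infty,E_\infty)$ be the Benjamini–Schramm limit of the hierarchical graphs with seed $G_1$, let $p_c$ be its (almost surely constant) critical value, and let $N$ be the number of infinite open connected components of the percolation configuration on $G_\infty$. Then for all $p>p_c$, $$\mathbf P_p^{\bar G_\infty}(N=1)=1\qquad\text{for almost every realization of }\bar G_\infty .$$
   Context: $G_1=(V_1,\mathcal E_1)$ is a finite connected oriented graph (a finite simple graph with an orientation chosen for each edge), with two distinguished vertices $a_1,b_1$. Orientations are used only to define the replacement operation below; distances, paths and connectivity ignore orientation. $d_1$ is the graph distance in $G_1$. Hierarchical graphs: $G_0$ is a single oriented edge $(a_0,b_0)$. Given $G_k=(V_k,\mathcal E_k)$ with distinguished vertices $a_k,b_k$, $G_{k+1}$ is obtained by replacing each oriented edge $(x,y)\in\mathcal E_k$ by a fresh copy of $G_1$, with $a_1$ identified with $x$ and $b_1$ with $y$; $a_{k+1},b_{k+1}$ are the vertices that were $a_k,b_k$. Benjamini–Schramm limit: let $\mathcal G$ be the space of connected, locally finite edge-rooted graphs (orientations forgotten) up to root-preserving isomorphism, with metric $d(\bar G,\bar G')=\inf\{1/(r+1):\bar G|_r\cong\bar G'|_r\}$, where $\bar G|_r$ is the rooted subgraph induced by vertices within distance $r$ of an endpoint of the root edge. With $E_k$ uniform in $\mathcal E_k$, the random elements $(G_k,E_k)$ converge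 in distribution in $\mathcal G$; the limit is the random edge-rooted infinite graph $\bar G_\infty=(G_\infty,E_\infty)$. Percolation on $\bar G_\infty$: given $\bar G_\infty$, under $\mathbf P_p^{\bar G_\infty}$ each edge of $G_\infty$ is independently open with probability $p$. $\theta^{\bar G_\infty}(p)$ is the $\mathbf P_p^{\bar G_\infty}$-probability that some endpoint of $E_\infty$ lies in an infinite open cluster, and $p_c=\sup\{p\in[0,1]:\theta^{\bar G_\infty}(p)=0\}$, which is almost surely constant, equal to the unique fixed point in $(0,1)$ of $p\mapsto f_1(p)$, where $f_1(p)$ is the probability that $a_1$ and $b_1$ are joined by an open path in $G_1$ with edges independently open with probability $p$. *)

(* Defs.v *)
From HB Require Import structures.
From mathcomp Require Import all_boot all_order all_algebra generic_quotient.
From mathcomp Require Import all_classical all_reals all_analysis measurable_realfun.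

Set Implicit Arguments.
Unset Strict Implicit.
Unset Printing Implicit Defensive.

Import Order.TTheory GRing.Theory Num.Theory.
Import numFieldNormedType.Exports.

Local Open Scope classical_set_scope.
Local Open Scope ring_scope.
Local Open Scope quotient_scope.

Section Distance.
Variables (T : eqType) (e : rel T).

Definition walk (x y : T) (n : nat) : Prop :=
  exists s : seq T, [/\ path e x s, last x s = y & size s = n].

Definition linked (x y : T) : Prop := exists s, path e x s /\ last x s = y.

(* The value 0 for vertices that are not linked is never used below: all the
   graphs considered are connected. *)
Definition gdist (x y : T) : nat :=
  match pselect (exists n, `[< walk x y n >]) with
  | left h => ex_minn h
  | right _ => 0
  end.

Lemma walkS x y z n : e x y -> walk y z n -> walk x z n.+1.
Proof. by move=> exy [s [ps ls ss]]; exists (y :: s); rewrite /= exy ps ss. Qed.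

Lemma linked_trans x y z : linked x y -> linked y z -> linked x z.
Proof.
move=> [s [ps <-]] [t [pt <-]]; exists (s ++ t).
by rewrite cat_path ps pt last_cat.
Qed.

Lemma linked_sym x y : symmetric e -> linked x y -> linked y x.
Proof.
move=> se [s [ps <-]]; exists (rev (belast x s)); split.
  by rewrite rev_path (eq_path (e' := e))// => u v; rewrite se.
by case: s ps => [//|a s] _ /=; rewrite rev_cons last_rcons.
Qed.

Lemma gdistP x y : linked x y -> walk x y (gdist x y).
Proof.
move=> [s [ps ls]]; rewrite /gdist; case: pselect => [h|[]].
  by case: ex_minnP => m /asboolP.
by exists (size s); apply/asboolP; exists s.
Qed.

Lemma gdist_le x y n : walk x y n -> (gdist x y <= n)%N.
Proof.
move=> w; rewrite /gdist; case: pselect => [h|//].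
by case: ex_minnP => m _; apply; apply/asboolP.
Qed.

End Distance.

(* Connected locally finite graphs are countable, so it is enough to consider
   vertex sets contained in [nat]. *)
Record egraph := EGraph {
  vert : set nat;
  adj : rel nat;
  root : nat * nat;
  adj_sym : symmetric adj;
  adj_irr : irreflexive adj;
  adj_vert : forall u v, adj u v -> vert u;
  root_adj : adj root.1 root.2;
  adj_conn : forall u v, vert u -> vert v -> linked adj u v;
  adj_locfin : forall u, finite_set [set v | adj u v] }.

HB.instance Definition _ := gen_eqMixin egraph.
HB.instance Definition _ := gen_choiceMixin egraph.

Definition gball (G : egraph) (r : nat) : set nat :=
  [set v | vert G v /\ ((gdist (adj G) (root G).1 v <= r)%N \/
                        (gdist (adj G) (root G).2 v <= r)%N)].

(* [f] is an isomorphism from the subgraph of [G] induced by [A] onto the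
   subgraph of [H] induced by [B]; the root is an unoriented edge. *)
Definition rooted_iso (G : egraph) (A : set nat) (H : egraph) (B : set nat)
    (f : nat -> nat) : Prop :=
  [/\ set_bij A B f,
      forall u v, A u -> A v -> adj H (f u) (f v) = adj G u v &
      (f (root G).1, f (root G).2) = root H \/
      (f (root G).2, f (root G).1) = root H].

Definition egraph_iso (G H : egraph) : Prop :=
  exists f, rooted_iso G (vert G) H (vert H) f.

Definition ball_iso (r : nat) (G H : egraph) : Prop :=
  exists f, rooted_iso G (gball G r) H (gball H r) f.

Section EgraphTheory.
Implicit Types (G H K : egraph) (A B C : set nat).

Lemma root1_vert G : vert G (root G).1.
Proof. exact: adj_vert (root_adj G). Qed.

Lemma root2_vert G : vert G (root G).2.
Proof. by apply: (@adj_vert G _ (root G).1); rewrite adj_sym root_adj. Qed.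

Lemma walk_vert G u v n : vert G u -> walk (adj G) u v n -> vert G v.
Proof.
move=> + [s [+ <- _]]; elim: s u => //= x s IH u uG /andP[ux]; apply: IH.
by apply: (@adj_vert _ _ u); rewrite adj_sym.
Qed.

Definition near_root G r v : Prop := exists2 n, (n <= r)%N &
  walk (adj G) (root G).1 v n \/ walk (adj G) (root G).2 v n.

Lemma gballP G r v : gball G r v <-> near_root G r v.
Proof.
split=> [[vG [h|h]]|[n nr [w|w]]].
- by eexists; [exact: h|left; apply/gdistP/adj_conn => //; exact: root1_vert].
- by eexists; [exact: h|right; apply/gdistP/adj_conn => //; exact: root2_vert].
- split; first exact: walk_vert (root1_vert G) w.
  by left; apply: leq_trans nr; exact: gdist_le.
- split; first exact: walk_vert (root2_vert G) w.
  by right; apply: leq_trans nr; exact: gdist_le.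
Qed.

Lemma gball_vert G r : gball G r `<=` vert G.
Proof. by move=> v []. Qed.

Lemma gball_le G r s : (r <= s)%N -> gball G r `<=` gball G s.
Proof.
move=> rs v [vG h]; split=> //.
by case: h => h; [left|right]; exact: leq_trans rs.
Qed.

Lemma gball_root1 G r : gball G r (root G).1.
Proof. by apply/gballP; exists 0%N => //; left; exists [::]. Qed.

Lemma gball_root2 G r : gball G r (root G).2.
Proof. by apply/gballP; exists 0%N => //; right; exists [::]. Qed.

Lemma vert_gball G v : vert G v -> exists r, gball G r v.
Proof. by move=> vG; exists (gdist (adj G) (root G).1 v); split => //; left. Qed.

Lemma walk_rcons G x y n : walk (adj G) x y n.+1 ->
  exists2 z, walk (adj G) x z n & adj G z y.
Proof.
move=> [s []]; case/lastP: s => // s z.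
rewrite rcons_path last_rcons size_rcons => /andP[ps sz] <- [<-].
by exists (last x s) => //; exists s.
Qed.

Lemma rcons_walk G x z y n : walk (adj G) x z n -> adj G z y ->
  walk (adj G) x y n.+1.
Proof.
move=> [s [ps <- <-]] zy; exists (rcons s y).
by rewrite rcons_path ps zy last_rcons size_rcons.
Qed.

Lemma gballS G r v : gball G r.+1 v ->
  gball G r v \/ exists2 u, gball G r u & adj G u v.
Proof.
move=> /gballP[n]; rewrite leq_eqVlt => /predU1P[->|].
  case=> /walk_rcons[z wz zv]; right; exists z => //; apply/gballP.
    by exists r => //; left.
  by exists r => //; right.
by rewrite ltnS => nr w; left; apply/gballP; exists n.
Qed.

Lemma gball_adj G r u v : gball G r u -> adj G u v -> gball G r.+1 v.
Proof.
move=> /gballP[n nr w] uv; apply/gballP; exists n.+1 => //.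
by case: w => w; [left|right]; exact: rcons_walk uv.
Qed.

Lemma gball0 G v : gball G 0 v -> v = (root G).1 \/ v = (root G).2.
Proof.
move=> /gballP[n]; rewrite leqn0 => /eqP -> [] [s [_]] /[swap] /size0nil ->.
  by move=> /= ->; left.
by move=> /= ->; right.
Qed.

Lemma gball_fin G r : finite_set (gball G r).
Proof.
elim: r => [|r IH].
  apply: (@sub_finite_set _ _ [set (root G).1; (root G).2]); last first.
    exact: finite_set2.
  by move=> v /gball0[]->; [left|right].
apply: (@sub_finite_set _ _
  (gball G r `|` \bigcup_(u in gball G r) [set v | adj G u v])).
  by move=> v /gballS[|[u ru uv]]; [left|right; exists u].
rewrite finite_setU; split => //.
by apply: bigcup_finite => // u _; exact: adj_locfin.
Qed.

Lemma iso_gball G H (A B : set nat) f r s : (s <= r)%N ->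
  gball G r `<=` A -> rooted_iso G A H B f ->
  forall v, gball G s v -> gball H s (f v).
Proof.
move=> + GA [fAB fadj froot]; elim: s => [|s IH] sr v.
  move=> /gball0 hv.
  have := gball_root1 H 0; have := gball_root2 H 0.
  by case: froot => <- /=; case: hv => ->.
move=> vs; have vA : A v by apply: GA; exact: gball_le vs.
have [/(IH (ltnW sr)) fv|[u us uv]] := gballS vs.
  exact: gball_le fv.
have uA : A u by apply: GA; apply: gball_le us; exact: ltnW.
by apply: gball_adj (IH (ltnW sr) _ us) _; rewrite fadj.
Qed.

Lemma rooted_iso_refl G A : rooted_iso G A G A id.
Proof.
split=> //; last by left; case: (root G).
by split=> //; rewrite /set_surj image_id.
Qed.

Lemma rooted_iso_comp G A H B K C f g : A (root G).1 -> A (root G).2 ->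
  rooted_iso G A H B f -> rooted_iso H B K C g -> rooted_iso G A K C (g \o f).
Proof.
move=> A1 A2 [fAB fadj fr] [gBC gadj gr]; split.
- exact: set_bij_comp fAB gBC.
- by move=> u v Au Av /=; rewrite gadj ?fadj//; apply: (set_bij_homo fAB).
- by case: fr gr => <- [] <- /=; [left|right|right|left].
Qed.

Lemma rooted_iso_inv G A H B f : rooted_iso G A H B f ->
  A (root G).1 -> A (root G).2 ->
  exists2 g, rooted_iso H B G A g & forall v, A v -> g (f v) = v.
Proof.
move=> [[fAB finj fsurj] fadj fr] A1 A2.
have /choice[g gP] : forall w, exists v, B w -> A v /\ f v = w.
  move=> w; have [Bw|nBw] := pselect (B w); last by exists 0%N.
  by have [v Av fv] := fsurj w Bw; exists v.
have gf v : A v -> g (f v) = v.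
  move=> Av; have [|Ag fg] := gP (f v); first exact: fAB.
  by apply: finj; rewrite ?inE.
exists g => //; split.
- split; first by move=> w /gP[].
    move=> w w'; rewrite !inE => /gP[_ {2}<-] /gP[_ {2}<-].
    by move=> ->.
  by move=> v Av; exists (f v); [exact: fAB|exact: gf].
- by move=> u v /gP[Au {2}<-] /gP[Av {2}<-]; rewrite fadj.
- by case: fr => <-; [left|right]; rewrite /= !gf//; case: (root G).
Qed.

Lemma rooted_iso_sub G A H B f r : gball G r `<=` A -> gball H r `<=` B ->
  rooted_iso G A H B f -> rooted_iso G (gball G r) H (gball H r) f.
Proof.
move=> GA HB fiso.
have [g giso gf] := rooted_iso_inv fiso (GA _ (@gball_root1 G r))
                                        (GA _ (@gball_root2 G r)).
have [[fAB finj fsurj] fadj fr] := fiso.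
split=> //; last by move=> u v /GA Au /GA Av; exact: fadj.
split.
- by move=> v; exact: (iso_gball (leqnn r) GA fiso).
- by move=> u v; rewrite !inE => /GA Au /GA Av; apply: finj; rewrite inE.
- move=> w wH; have [v Av fv] := fsurj w (HB _ wH).
  exists v => //; rewrite -(gf v Av) fv.
  exact: (iso_gball (leqnn r) HB giso).
Qed.

Lemma ball_iso_refl r G : ball_iso r G G.
Proof. by exists id; exact: rooted_iso_refl. Qed.

Lemma ball_iso_sym r G H : ball_iso r G H -> ball_iso r H G.
Proof.
move=> [f /rooted_iso_inv[]]; [exact: gball_root1|exact: gball_root2|].
by move=> g giso _; exists g.
Qed.

Lemma ball_iso_trans r G H K :
  ball_iso r G H -> ball_iso r H K -> ball_iso r G K.
Proof.
move=> [f fi] [g gi]; exists (g \o f); apply: rooted_iso_comp fi gi.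
  exact: gball_root1.
exact: gball_root2.
Qed.

Lemma ball_iso_le r s G H : (s <= r)%N -> ball_iso r G H -> ball_iso s G H.
Proof.
by move=> sr [f fi]; exists f; apply: rooted_iso_sub fi; exact: gball_le.
Qed.

Lemma ball_iso0 G H : ball_iso 0 G H.
Proof.
have ne K : (root K).1 != (root K).2.
  by apply/eqP => E; have := root_adj K; rewrite E adj_irr.
pose f v := if v == (root G).1 then (root H).1 else (root H).2.
have f1 : f (root G).1 = (root H).1 by rewrite /f eqxx.
have f2 : f (root G).2 = (root H).2 by rewrite /f eq_sym (negbTE (ne G)).
exists f; split; last by left; rewrite f1 f2; case: (root H).
- split.
  + move=> v /gball0[]->; rewrite (f1, f2);
      [exact: gball_root1|exact: gball_root2].
  + move=> u v; rewrite !inE => /gball0[]-> /gball0[]->; rewrite ?f1 ?f2//.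
      by move/eqP; rewrite (negbTE (ne H)).
    by move/eqP; rewrite eq_sym (negbTE (ne H)).
  + move=> w /gball0[]->.
      by exists (root G).1 => //; exact: gball_root1.
    by exists (root G).2 => //; exact: gball_root2.
- move=> u v /gball0[]-> /gball0[]->; rewrite ?f1 ?f2 ?adj_irr ?root_adj//.
  by rewrite ![adj _ (root _).2 _]adj_sym !root_adj.
Qed.

Lemma egraph_iso_ball r G H : egraph_iso G H -> ball_iso r G H.
Proof.
by move=> [f fi]; exists f; apply: rooted_iso_sub fi; exact: gball_vert.
Qed.

(* An ultrafilter limit of isomorphisms of balls is an isomorphism. *)
Lemma ball_iso_egraph G H : (forall r, ball_iso r G H) -> egraph_iso G H.
Proof.
move=> /choice[F Fiso].
have [U [UU UF]] := @ultraFilterLemma nat \oo _.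
have Ufin (P : nat -> nat -> Prop) (S : set nat) : finite_set S ->
    U [set r | exists2 w, S w & P r w] ->
    exists2 w, S w & U [set r | P r w].
  move=> /finite_seqP[s ->] {S}; elim: s => [|x s IH] h.
    exfalso; apply: (@filter_not_empty _ U).
    by apply: filterS h => r [w]; rewrite /= in_nil.
  have [Px|nPx] := in_ultra_setVsetC [set r | P r x] UU.
    by exists x => //=; rewrite inE eqxx.
  have [|w ws Uw] := IH.
    apply: filterS (filterI h nPx) => r [[w /= + Pw] nP].
    by rewrite inE => /predU1P[E|ws]; [case: nP; rewrite /= -E|exists w].
  by exists w => //=; rewrite inE ws orbT.
have Ule n : U [set r | (n <= r)%N] by apply: UF; exact: nbhs_infty_ge.
have Fle r s : (s <= r)%N -> rooted_iso G (gball G s) H (gball H s) (F r).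
  by move=> sr; apply: rooted_iso_sub (Fiso r); exact: gball_le.
have /choice[f fP] : forall v, exists w, vert G v -> U [set r | F r v = w].
  move=> v; have [vG|nv] := pselect (vert G v); last by exists 0%N.
  have [n vn] := vert_gball vG.
  have [|w _ Uw] := Ufin (fun r w => F r v = w) _ (gball_fin H n).
    apply: filterS (Ule n) => r nr /=; exists (F r v) => //.
    by have [/set_bij_homo + _ _] := Fle _ _ nr; apply.
  by exists w.
have Uex (A : set nat) : U A -> exists r, A r.
  exact: filter_ex.
have two (P : nat -> Prop) u v : vert G u -> vert G v -> U P ->
    exists r, [/\ P r, F r u = f u, F r v = f v,
      rooted_iso G (gball G r) H (gball H r) (F r) &
      gball G r u /\ gball G r v].
  move=> uG vG UP; have [n un] := vert_gball uG; have [m vm] := vert_gball vG.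
  have [r [[[/= Pr fu] fv] rle]] := Uex _ (filterI
    (filterI (filterI UP (fP u uG)) (fP v vG)) (Ule (maxn n m))).
  exists r; split=> //; split.
    by apply: gball_le un; apply: leq_trans rle; exact: leq_maxl.
  by apply: gball_le vm; apply: leq_trans rle; exact: leq_maxr.
have UT : U setT by exact: filterT.
exists f; split.
- split.
  + move=> v vG; have [r [_ fv _ [FB _ _] [_ rv]]] := two _ v v vG vG UT.
    by rewrite -fv; apply: (@gball_vert _ r); exact: set_bij_homo FB _ rv.
  + move=> u v; rewrite !inE => uG vG fuv.
    have [r [_ fu fv [FB _ _] [ru rv]]] := two _ u v uG vG UT.
    by apply: (set_bij_inj FB); rewrite ?inE// fu fv.
  + move=> w wH; have [n wn] := vert_gball wH.
    have [|v vn Uv] := Ufin (fun r v => F r v = w) _ (gball_fin G n).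
      apply: filterS (Ule n) => r nr /=.
      by have [/set_bij_surj/(_ w wn)[v] + + _ _] := Fle _ _ nr; exists v.
    have vG := gball_vert vn; exists v => //.
    by have [r [/= <- <-]] := two _ v v vG vG Uv.
- move=> u v uG vG; have [r [_ <- <- [_ Fadj _] [ru rv]]] := two _ u v uG vG UT.
  exact: Fadj.
- have [r [_ <- <- [_ _ Fr] _]] :=
    two _ _ _ (root1_vert G) (root2_vert G) UT.
  exact: Fr.
Qed.

Lemma egraph_iso_refl G : egraph_iso G G.
Proof. by exists id; exact: rooted_iso_refl. Qed.

Lemma egraph_iso_sym G H : egraph_iso G H -> egraph_iso H G.
Proof.
move=> [f /rooted_iso_inv[]]; [exact: root1_vert|exact: root2_vert|].
by move=> g giso _; exists g.
Qed.

Lemma egraph_iso_trans G H K :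
  egraph_iso G H -> egraph_iso H K -> egraph_iso G K.
Proof.
move=> [f fi] [g gi]; exists (g \o f); apply: rooted_iso_comp fi gi.
  exact: root1_vert.
exact: root2_vert.
Qed.

End EgraphTheory.

Definition egraph_isob : rel egraph := fun G H => `[< egraph_iso G H >].

Lemma egraph_isob_refl : reflexive egraph_isob.
Proof. by move=> G; apply/asboolP; exact: egraph_iso_refl. Qed.

Lemma egraph_isob_sym : symmetric egraph_isob.
Proof. by move=> G H; apply/asboolP/asboolP; exact: egraph_iso_sym. Qed.

Lemma egraph_isob_trans : transitive egraph_isob.
Proof.
move=> G H K /asboolP h1 /asboolP h2; apply/asboolP.
exact: egraph_iso_trans h1 h2.
Qed.

Canonical egraph_equiv :=
  EquivRel egraph_isob egraph_isob_refl egraph_isob_sym egraph_isob_trans.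

(* The field [R] only serves to fix the values of the distance. *)
Definition egspace (R : realType) : Type := {eq_quot egraph_equiv}.

HB.instance Definition _ (R : realType) := Choice.on (egspace R).

Section EgspaceMetric.
Variable R : realType.
Implicit Types x y z : egspace R.

Definition egclass (G : egraph) : egspace R := \pi_{eq_quot egraph_equiv} G.

Definition egrepr x : egraph := repr (x : {eq_quot egraph_equiv}).

Lemma egreprK : cancel egrepr egclass.
Proof. exact: reprK. Qed.

Lemma egclass_eq (G H : egraph) : egclass G = egclass H <-> egraph_iso G H.
Proof.
split=> [/eqmodP/asboolP //|h]; apply/eqmodP; exact/asboolP.
Qed.

Definition egdist x y : R :=
  inf [set (r.+1%:R)^-1 | r in [set r | ball_iso r (egrepr x) (egrepr y)]].

Let has_inf_egdist x y : has_inf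
  [set ((r.+1%:R)^-1 : R) | r in [set r | ball_iso r (egrepr x) (egrepr y)]].
Proof.
split; first by exists (1%:R^-1), 0%N => //; exact: ball_iso0.
by exists 0 => _ [r _ <-].
Qed.

Lemma egdist_le r x y :
  ball_iso r (egrepr x) (egrepr y) -> egdist x y <= (r.+1%:R)^-1.
Proof. by move=> h; apply: ge_inf; [case: (has_inf_egdist x y)|exists r]. Qed.

Lemma egdist_lt x y e : egdist x y < e ->
  exists2 r, ball_iso r (egrepr x) (egrepr y) & (r.+1%:R)^-1 < e.
Proof.
by move=> /(inf_lt (has_inf_egdist x y).1)[_ [r hr <-]] ?; exists r.
Qed.

Lemma egdist_ge0 x y : 0 <= egdist x y.
Proof. by apply: lb_le_inf; [case: (has_inf_egdist x y)|move=> _ [r _ <-]]. Qed.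

Lemma egdistxx x : egdist x x = 0.
Proof.
apply/eqP; rewrite eq_le egdist_ge0 andbT leNgt; apply/negP => d0.
have [n] := ltr_add_invr d0; rewrite add0r => nd.
by have := lt_le_trans nd (egdist_le (ball_iso_refl n (egrepr x))); rewrite ltxx.
Qed.

Lemma egdist_positivity x y : egdist x y = 0 -> x = y.
Proof.
move=> xy0; rewrite -(egreprK x) -(egreprK y); apply/egclass_eq.
apply: ball_iso_egraph => r.
have [|s + sr] := @egdist_lt x y (r.+1%:R)^-1; first by rewrite xy0 invr_gt0.
apply: ball_iso_le; move: sr; rewrite ltf_pV2 ?posrE// ltr_nat.
by move/ltnW.
Qed.

Lemma egdist_sym x y : egdist x y = egdist y x.
Proof.
by congr (inf (image _ _)); apply/seteqP; split=> r; exact: ball_iso_sym.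
Qed.

Lemma egdist_triangle y x z : egdist x z <= egdist x y + egdist y z.
Proof.
rewrite leNgt; apply/negP => h.
have [r xy rlt] : exists2 r, ball_iso r (egrepr x) (egrepr y) &
    (r.+1%:R)^-1 < egdist x z.
  by apply: egdist_lt; apply: le_lt_trans h; rewrite lerDl egdist_ge0.
have [s yz slt] : exists2 s, ball_iso s (egrepr y) (egrepr z) &
    (s.+1%:R)^-1 < egdist x z.
  by apply: egdist_lt; apply: le_lt_trans h; rewrite lerDr egdist_ge0.
have xz : ball_iso (minn r s) (egrepr x) (egrepr z).
  by apply: ball_iso_trans (ball_iso_le _ xy) (ball_iso_le _ yz);
    [exact: geq_minl|exact: geq_minr].
have := egdist_le xz; rewrite leNgt => /negP; apply.
by rewrite /minn; case: ifP.
Qed.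

HB.instance Definition _ := isMetric.Build R (egspace R)
  egdistxx egdist_positivity egdist_sym egdist_triangle.

End EgspaceMetric.

Record ograph := OGraph {
  overt :> finType;
  oedge : rel overt;
  src : overt;
  tgt : overt;
  oedge_asym : forall x y, oedge x y -> ~~ oedge y x;
  ograph_conn : forall x y,
    connect (fun u v => oedge u v || oedge v u) x y;
  src_neq_tgt : src != tgt }.

Arguments oedge : clear implicits.
Arguments src : clear implicits.
Arguments tgt : clear implicits.

Definition uadj (G : ograph) : rel G := fun u v => oedge G u v || oedge G v u.

Definition edge (G : ograph) : finType := {xy : G * G | oedge G xy.1 xy.2}.

Definition uedges (G : ograph) (x : G) (s : seq G) : seq {set G} :=
  [seq [set xy.1; xy.2]%SET | xy <- zip (x :: s) s].

Definition is_path (G : ograph) (x y : G) (s : seq G) : Prop :=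
  [/\ path (@uadj G) x s, last x s = y & uniq (x :: s)].

Definition two_edge_disjoint_paths (G : ograph) (x y : G) : Prop :=
  exists s t : seq G, [/\ is_path x y s, is_path x y t &
    ~~ has (mem (uedges x s)) (uedges x t)].

Section SingleEdge.

Definition single_rel : rel bool := fun x y => ~~ x && y.

Lemma single_asym x y : single_rel x y -> ~~ single_rel y x.
Proof. by case: x; case: y. Qed.

Lemma single_conn x y :
  connect (fun u v => single_rel u v || single_rel v u) x y.
Proof. by case: x; case: y => //; apply: connect1. Qed.

Definition single_edge : ograph :=
  @OGraph bool single_rel false true single_asym single_conn isT.

End SingleEdge.

Section Replace.
Variables H G : ograph.

Definition inner : finType := {v : G | (v != src G) && (v != tgt G)}.

Definition replace_vert : finType := (H + edge H * inner)%type.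

(* The image of the vertex [v] of [G] in the copy of [G] replacing [e]. *)
Definition copy (e : edge H) (v : G) : replace_vert :=
  if insub v is Some w then inr (e, w)
  else if v == src G then inl (val e).1 else inl (val e).2.

Definition replace_rel : rel replace_vert := fun x y =>
  [exists e : edge H, exists u : G, exists v : G,
    [&& oedge G u v, x == copy e u & y == copy e v]].

Lemma copy_src e : copy e (src G) = inl (val e).1.
Proof. by rewrite /copy insubF ?eqxx. Qed.

Lemma copy_tgt e : copy e (tgt G) = inl (val e).2.
Proof.
by rewrite /copy insubF ?eqxx ?andbF// eq_sym (negbTE (src_neq_tgt G)).
Qed.

Lemma copy_inner e (w : inner) : copy e (val w) = inr (e, w).
Proof. by rewrite /copy valK. Qed.

Lemma copyP (v : G) : [\/ v = src G, v = tgt G | exists w : inner, v = val w].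
Proof.
have [->|ns] := eqVneq v (src G); first by constructor 1.
have [->|nt] := eqVneq v (tgt G); first by constructor 2.
have h : (v != src G) && (v != tgt G) by rewrite ns nt.
by constructor 3; exists (Sub v h : inner).
Qed.

Lemma edge_neq (e : edge H) : (val e).1 != (val e).2.
Proof.
apply/eqP => E; have := valP e; rewrite E => h.
by have := oedge_asym h; rewrite h.
Qed.

Lemma copy_inj e : injective (copy e).
Proof.
have ne := edge_neq e; move=> u v.
case: (copyP u) => [->|->|[w ->]]; case: (copyP v) => [->|->|[w' ->]];
rewrite ?copy_src ?copy_tgt ?copy_inner//;
by case=> E; first [by rewrite E | by move: ne; rewrite E eqxx].
Qed.

Lemma copy_edge_asym e e' u v u' v' : oedge G u v -> oedge G u' v' ->
  copy e u = copy e' v' -> copy e v = copy e' u' -> False.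
Proof.
move=> uv uv'; have [<-|nee'] := eqVneq e e'.
  move=> /copy_inj uv'E /copy_inj vu'E; move: uv'.
  by rewrite -uv'E -vu'E => h; have := oedge_asym uv; rewrite h.
have irr x : oedge G x x = false.
  by apply/negP => h; have := oedge_asym h; rewrite h.
have c1 : (val e).1 = (val e').2 -> (val e).2 = (val e').1 -> False.
  move=> h1 h2; have := valP e; rewrite h1 h2 => h.
  by have := oedge_asym h; rewrite (valP e').
have c2 : (val e).1 = (val e').1 -> (val e).2 = (val e').2 -> False.
  move=> h1 h2; move/eqP: nee'; apply; apply: val_inj.
  by rewrite [LHS]surjective_pairing h1 h2 -surjective_pairing.
have c3 (w w' : inner) : inr (e, w) = inr (e', w') :> replace_vert -> False.
  by move=> [E _]; rewrite E eqxx in nee'.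
move: uv uv'.
case: (copyP u) => [->|->|[w ->]]; case: (copyP v') => [->|->|[w' ->]];
case: (copyP v) => [->|->|[z ->]]; case: (copyP u') => [->|->|[z' ->]];
rewrite ?copy_src ?copy_tgt ?copy_inner ?irr//;
by move=> _ _ h1 h2; first
  [exact: (c3 _ _ h1) | exact: (c3 _ _ h2)
  | move: h1 h2 => [h1] [h2]; first
    [exact: c1 h1 h2 | exact: c1 h2 h1 | exact: c2 h1 h2 | exact: c2 h2 h1]].
Qed.

Lemma replace_asym x y : replace_rel x y -> ~~ replace_rel y x.
Proof.
move=> /existsP[e /existsP[u /existsP[v /and3P[uv /eqP -> /eqP ->]]]].
apply/negP => /existsP[e' /existsP[u' /existsP[v' /and3P[uv' /eqP h2 /eqP h1]]]].
exact: copy_edge_asym uv uv' h1 h2.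
Qed.

Let radj : rel replace_vert := fun x y => replace_rel x y || replace_rel y x.

Let radj_csym : connect_sym radj.
Proof. by apply: sym_connect_sym => x y; rewrite /radj orbC. Qed.

Lemma copy_conn e u v : connect radj (copy e u) (copy e v).
Proof.
have /connectP[s ps ->] := ograph_conn u v.
elim: s u ps => [|x s IH] u //= /andP[ux /IH]; apply: connect_trans.
apply: connect1; rewrite /radj /replace_rel.
by case/orP: ux => h; apply/orP; [left|right]; apply/existsP; exists e;
   apply/existsP; [exists u|exists x]; apply/existsP; [exists x|exists u];
   rewrite h !eqxx.
Qed.

Lemma inl_conn x y : connect radj (inl x) (inl y).
Proof.
have /connectP[s ps ->] := ograph_conn x y.
elim: s x ps => [|z s IH] x //= /andP[xz /IH]; apply: connect_trans.
case/orP: xz => h.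
  have := copy_conn (Sub (x, z) h) (src G) (tgt G).
  by rewrite copy_src copy_tgt.
have := copy_conn (Sub (z, x) h) (tgt G) (src G).
by rewrite copy_src copy_tgt.
Qed.

Lemma replace_conn x y : connect radj x y.
Proof.
have h z : connect radj z (inl (src H)).
  case: z => [z|[e w]]; first exact: inl_conn.
  rewrite -copy_inner; apply: connect_trans (copy_conn e _ (src G)) _.
  by rewrite copy_src; exact: inl_conn.
by apply: connect_trans (h x) _; rewrite radj_csym.
Qed.

Lemma replace_src_neq_tgt :
  (inl (src H) : replace_vert) != inl (tgt H).
Proof. by apply/eqP => -[] /eqP; rewrite (negbTE (src_neq_tgt H)). Qed.

Definition replace : ograph := OGraph replace_asym replace_conn
  replace_src_neq_tgt.

End Replace.

Fixpoint hier (G : ograph) (k : nat) : ograph :=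
  if k is k'.+1 then replace (hier G k') G else single_edge.

(* A finite oriented graph with a distinguished edge, with its orientation
   forgotten and its vertices numbered by [enum_rank]. *)
Section Rooted.
Variables (G : ograph) (e : edge G).

Let num (v : G) : nat := enum_rank v.

Let num_inj : injective num.
Proof. by move=> u v /val_inj/enum_rank_inj. Qed.

Let fvert : set nat := range num.

Let fadj : rel nat := fun n m =>
  [exists u : G, exists v : G, [&& n == num u, m == num v & uadj u v]].

Let fadjP n m : reflect (exists u v, [/\ n = num u, m = num v & uadj u v])
  (fadj n m).
Proof.
apply: (iffP existsP) => [[u /existsP[v /and3P[/eqP -> /eqP -> uv]]]|].
  by exists u, v.
by move=> [u [v [-> -> uv]]]; exists u; apply/existsP; exists v; rewrite !eqxx.
Qed.

Let fadjE u v : fadj (num u) (num v) = uadj u v.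
Proof.
apply/fadjP/idP => [[u' [v' [/num_inj -> /num_inj -> //]]]|h].
by exists u, v.
Qed.

Let fadj_sym : symmetric fadj.
Proof.
have h n m : fadj n m -> fadj m n.
  by move=> /fadjP[u [v [-> -> uv]]]; rewrite fadjE /uadj orbC.
by move=> n m; apply/idP/idP; exact: h.
Qed.

Let fadj_irr : irreflexive fadj.
Proof.
move=> n; case E : (fadj n n) => //.
have [u [v [-> /num_inj -> +]]] := fadjP _ _ E.
by rewrite /uadj orbb => h; have := oedge_asym h; rewrite h.
Qed.

Let fadj_vert n m : fadj n m -> fvert n.
Proof. by move=> /fadjP[u [v [-> _ _]]]; exists u. Qed.

Let froot_adj : fadj (num (val e).1) (num (val e).2).
Proof. by rewrite fadjE /uadj (valP e). Qed.

Let fadj_conn n m : fvert n -> fvert m -> linked fadj n m.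
Proof.
move=> [u _ <-] [v _ <-]; have /connectP[s ps ->] := ograph_conn u v.
exists (map num s); split; last by rewrite last_map.
elim: s u ps => //= x s IH u /andP[ux /IH ->]; rewrite andbT.
by rewrite fadjE.
Qed.

Let fadj_locfin n : finite_set [set m | fadj n m].
Proof.
apply: (@sub_finite_set _ _ (range num)); last exact: finite_image.
by move=> m /fadjP[u [v [_ -> _]]]; exists v.
Qed.

Definition rooted : egraph := @EGraph fvert fadj
  (num (val e).1, num (val e).2) fadj_sym fadj_irr fadj_vert froot_adj
  fadj_conn fadj_locfin.

End Rooted.

HB.instance Definition _ (R : realType) := isPointed.Build (egspace R)
  (egclass R (@rooted single_edge (Sub (false, true) isT))).

Definition egspace_borel (R : realType) :=
  g_sigma_algebraType (@open (egspace R)).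

(* Convergence in distribution of [(G_k, E_k)] to [mu]: the expectation over
   the uniform edge [E_k] is a finite average. *)
Definition is_bs_limit (R : realType) (G : ograph)
    (mu : probability (egspace_borel R) R) : Prop :=
  forall f : egspace R -> R, continuous f -> (exists M : R, forall x, `|f x| <= M) ->
  (fun k => (\sum_(e : edge (hier G k)) f (egclass R (rooted e))) /
            #|edge (hier G k)|%:R) @ \oo --> (\int[mu]_x f x)%R.

Section BernoulliProduct.
Variable T : countType.

Definition cylinders : set (set (T -> bool)) :=
  [set [set w : T -> bool | w t] | t in [set: T]].

Definition config := g_sigma_algebraType cylinders.

Variables (R : realType) (p : R).

(* If [u] is uniform on [0, 1], then [u < p] is a Bernoulli([p]) variable, and
   conditionally on its value [bstep u] is again uniform on [0, 1]. *)
Definition bstep (u : R) : R := if u < p then u / p else (u - p) / (1 - p).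

Definition bcode (u : measurableTypeR R) : config := fun t => iter (pickle t) bstep u < p.

Lemma measurable_bstep : measurable_fun [set: R] bstep.
Proof.
apply: measurable_fun_ifT.
- exact: measurable_fun_ltr.
- exact: measurable_funM.
- by apply: measurable_funM => //; exact: measurable_funB.
Qed.

Lemma measurable_iter_bstep n : measurable_fun [set: R] (iter n bstep).
Proof.
elim: n => [|n IH]; first exact: measurable_id.
by apply: (measurableT_comp measurable_bstep).
Qed.

Lemma measurable_bcode : measurable_fun [set: measurableTypeR R] bcode.
Proof.
apply: (@measurability _ _ R config _ bcode cylinders erefl).
move=> _ [_ [t _ <-] <-]; rewrite setTI.
rewrite (_ : _ @^-1` _ = (iter (pickle t) bstep) @^-1` `]-oo, p[%classic).
  by rewrite -[X in measurable X]setTI; apply: measurable_iter_bstep.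
by apply/seteqP; split=> u; rewrite /= in_itv.
Qed.

HB.instance Definition _ :=
  isMeasurableFun.Build _ _ (measurableTypeR R) config bcode measurable_bcode.

Definition bernoulli_product : probability config R :=
  distribution (uniform_prob (@ltr01 R)) bcode.

Hypothesis p01 : 0 <= p <= 1.

Let q (b : bool) : R := if b then p else 1 - p.

Local Notation U := (uniform_prob (@ltr01 R)).

Let uniform_itv (A : set R) l r : measurable A -> l <= r -> 0 <= l -> r <= 1 ->
  (forall u, 0 <= u < 1 -> (A u <-> l <= u < r)) -> U A = (r - l)%:E.
Proof.
move=> mA lr l0 r1 Alr.
have mA01 : measurable (A `&` `[0, 1]) by exact: measurableI.
have -> : U A = lebesgue_measure (A `&` `[0, 1]).
  rewrite /uniform_prob integral_uniform_pdf.
  rewrite (eq_integral (cst 1%E)); last first.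
    by move=> u; rewrite inE/= in_itv/= => -[_ u01];
      rewrite /uniform_pdf u01 subr0 invr1.
  by rewrite integral_cst// mul1e.
have lmlr : lebesgue_measure `[l, r[%classic = (r - l)%:E :> \bar R.
  rewrite lebesgue_measure_itv/= lte_fin; case: ltP => // rl.
  by rewrite (le_anti (introT andP (conj lr rl))) subrr.
apply/eqP; rewrite eq_le; apply/andP; split; last first.
  rewrite -lmlr; apply: le_measure; rewrite ?inE//.
  move=> u; rewrite /= !in_itv/= => /andP[lu ur].
  have u1 := lt_le_trans ur r1; have u0 := le_trans l0 lu.
  by split; [apply/Alr; rewrite ?u0 ?lu|rewrite u0 ltW].
rewrite -lmlr -[leRHS]adde0 -(lebesgue_measure_set1 (1 : R)).
apply: (@le_trans _ _ (lebesgue_measure (`[l, r[%classic `|` [set 1]))).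
  apply: le_measure; rewrite ?inE//; first exact: measurableU.
  move=> u [Au]; rewrite /= !in_itv/= => /andP[u0].
  rewrite le_eqVlt => /predU1P[->|u1]; [by right|left].
  by apply/Alr; rewrite ?u0.
exact: measureU2.
Qed.

Let agree (c : seq bool) (u : R) : Prop :=
  forall i, (i < size c)%N -> (iter i bstep u < p) = nth true c i.

Let agree_itv c : exists l r, [/\ 0 <= l, l <= r, r <= 1,
  r - l = \prod_(b <- c) q b &
  forall u, 0 <= u < 1 -> (agree c u <-> l <= u < r)].
Proof.
have /andP[p0 p1] := p01.
elim: c => [|b c [l [r [l0 lr r1 rl IH]]]].
  by exists 0, 1; rewrite big_nil subr0; split=> // u ->.
have agreeS u : agree (b :: c) u <-> (u < p) = b /\ agree c (bstep u).
  split=> [h|[h1 h2] [|i] //= ic].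
    by split; [exact: (h 0%N)|move=> i ic; rewrite -iterSr; exact: (h i.+1)].
  by rewrite -/(iter i.+1 bstep u) iterSr; exact: h2.
have q0 : 0 <= 1 - p by rewrite subr_ge0.
case: b agreeS => agreeS.
- exists (p * l), (p * r); split.
  + exact: mulr_ge0.
  + exact: ler_wpM2l.
  + by apply: mulr_ile1 => //; exact: le_trans lr.
  + by rewrite big_cons /= -mulrBr rl.
  + move=> u /andP[u0 u1]; rewrite agreeS; split.
      move=> [up]; have pp : 0 < p := le_lt_trans u0 up.
      have h01 : 0 <= u / p < 1.
        by rewrite divr_ge0//= ltr_pdivrMr// mul1r.
      rewrite /bstep up => /(IH _ h01).
      by rewrite ler_pdivlMr// ltr_pdivrMr// ![_ * p]mulrC.
    move=> /andP[plu upr].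
    have up : u < p by apply: lt_le_trans upr _; rewrite ler_piMr.
    have pp : 0 < p := le_lt_trans u0 up.
    split=> //; rewrite /bstep up; apply/IH.
      by rewrite divr_ge0//= ltr_pdivrMr// mul1r.
    by rewrite ler_pdivlMr// ltr_pdivrMr// ![_ * p]mulrC plu.
- exists (p + (1 - p) * l), (p + (1 - p) * r); split.
  + by rewrite addr_ge0// mulr_ge0.
  + by rewrite lerD2l ler_wpM2l.
  + by rewrite -lerBrDl ler_piMr.
  + by rewrite big_cons /= -rl mulrBr opprD addrACA subrr add0r.
  + move=> u /andP[u0 u1]; rewrite agreeS; split.
      move=> [up]; have {up}pu : p <= u by rewrite leNgt up.
      have pp : 0 < 1 - p by rewrite subr_gt0; exact: le_lt_trans u1.
      have h01 : 0 <= (u - p) / (1 - p) < 1.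
        by rewrite divr_ge0 ?subr_ge0//= ltr_pdivrMr// mul1r ltrD2r.
      rewrite /bstep ltNge pu/= => /(IH _ h01).
      rewrite ler_pdivlMr// ltr_pdivrMr//.
      by rewrite lerBrDl ltrBlDl ![_ * (1 - p)]mulrC.
    move=> /andP[plu upr].
    have pu : p <= u by apply: le_trans plu; rewrite lerDl mulr_ge0.
    have pp : 0 < 1 - p by rewrite subr_gt0; exact: le_lt_trans u1.
    split; first by rewrite ltNge pu.
    rewrite /bstep ltNge pu/=; apply/IH.
      by rewrite divr_ge0 ?subr_ge0//= ltr_pdivrMr// mul1r ltrD2r.
    rewrite ler_pdivlMr// ltr_pdivrMr// lerBrDl ltrBlDl.
    by rewrite ![_ * (1 - p)]mulrC plu.
Qed.

Let measurable_digit i b : measurable [set u | (iter i bstep u < p) = b].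
Proof.
rewrite -[X in measurable X]setTI.
have := measurable_fun_ltr (@measurable_iter_bstep i)
  (@measurable_cst _ _ _ _ setT p).
by move=> /(_ measurableT [set b]); apply.
Qed.

Let agreeo (a : nat -> option bool) (n m : nat) (u : R) : Prop :=
  forall i, (n <= i < m)%N -> forall b, a i = Some b -> (iter i bstep u < p) = b.

Let qo (o : option bool) : R := if o is Some b then q b else 1.

Let measurable_agree c : measurable [set u | agree c u].
Proof.
have -> : [set u | agree c u] =
    \bigcap_(i in `I_(size c)) [set u | (iter i bstep u < p) = nth true c i].
  by apply/seteqP; split=> u h i /h.
by apply: bigcap_measurableType => // i _; exact: measurable_digit.
Qed.

Let measurable_agreeo a n m : measurable [set u | agreeo a n m u].
Proof.
have -> : [set u | agreeo a n m u] = \bigcap_i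
    (if (n <= i < m)%N then (if a i is Some b then
       [set u | (iter i bstep u < p) = b] else setT) else setT).
  apply/seteqP; split=> u h i.
    move=> _; case: ifP => // nim; case E : (a i) => [b|//].
    exact: h.
  by move=> nim b E; have := h i I; rewrite nim E.
apply: bigcap_measurableType => i _; case: ifP => // _.
by case: (a i) => [b|//]; exact: measurable_digit.
Qed.

Let uniform_agree a c k : U ([set u | agree c u] `&`
    [set u | agreeo a (size c) (size c + k) u]) =
  (\prod_(b <- c) q b * \prod_(size c <= i < size c + k) qo (a i))%:E.
Proof.
elim: k c => [|k IH] c.
  rewrite addn0 big_geq// mulr1.
  have -> : [set u | agree c u] `&` [set u | agreeo a (size c) (size c) u] =
      [set u | agree c u].
    apply/seteqP; split=> u; first by case.
    by move=> h; split=> // i; rewrite ltnNge => /andP[->].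
  by have [l [r [l0 lr r1 <- h]]] := agree_itv c; apply: uniform_itv.
have agree_rcons b u : agree (rcons c b) u <->
    agree c u /\ (iter (size c) bstep u < p) = b.
  split=> [h|[h1 h2] i]; rewrite ?size_rcons.
    split=> [i ic|]; last first.
      by rewrite h ?size_rcons// nth_rcons ltnn eqxx.
    by rewrite h ?size_rcons 1?ltnW// nth_rcons ic.
  by rewrite ltnS leq_eqVlt nth_rcons => /predU1P[->|ic];
    rewrite ?ltnn ?eqxx// ic; exact: h1.
have agreeoS u : agreeo a (size c) (size c + k.+1) u <->
    (forall b, a (size c) = Some b -> (iter (size c) bstep u < p) = b) /\
    agreeo a (size c).+1 ((size c).+1 + k) u.
  rewrite addnS -addSn; split=> [h|[h1 h2] i /andP[ci ik]].
    split=> [b|i /andP[ci ik]].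
      by apply: h; rewrite leqnn addSn ltnS leq_addr.
    by apply: h; rewrite ltnW.
  move: ci; rewrite leq_eqVlt => /predU1P[<-//|ci].
  by apply: h2; rewrite ci ik.
have prodS : \prod_(size c <= i < size c + k.+1) qo (a i) =
    qo (a (size c)) * \prod_((size c).+1 <= i < (size c).+1 + k) qo (a i).
  by rewrite big_ltn ?addnS ?ltnS ?leq_addr.
have IH' b := IH (rcons c b).
have {IH'}IH' b : U ([set u | agree (rcons c b) u] `&`
      [set u | agreeo a (size c).+1 ((size c).+1 + k) u]) =
    (\prod_(x <- c) q x * q b *
     \prod_((size c).+1 <= i < (size c).+1 + k) qo (a i))%:E.
  by have := IH' b; rewrite size_rcons -cats1 big_cat big_seq1.
rewrite prodS mulrA; case E : (a (size c)) => [b|].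
  rewrite -IH'; congr (U _); apply/seteqP; split=> u /= [].
    by move=> h /agreeoS[h1 h2]; split=> //; apply/agree_rcons; split=> //; exact: h1.
  move=> /agree_rcons[h1 h2] h3; split=> //; apply/agreeoS; split=> // b'.
  by rewrite E => -[<-].
rewrite mulr1.
have -> : [set u | agree c u] `&`
    [set u | agreeo a (size c) (size c + k.+1) u] =
    ([set u | agree (rcons c true) u] `&`
      [set u | agreeo a (size c).+1 ((size c).+1 + k) u]) `|`
    ([set u | agree (rcons c false) u] `&`
      [set u | agreeo a (size c).+1 ((size c).+1 + k) u]).
  apply/seteqP; split=> u /=.
    move=> [h /agreeoS[_ h2]].
    by case D : (iter (size c) bstep u < p); [left|right]; split=> //;
      apply/agree_rcons.
  by case=> -[/agree_rcons[h1 _] h3]; split=> //; apply/agreeoS; split=> // b';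
    rewrite E.
rewrite measureU; [|apply: measurableI; [exact: measurable_agree|exact: measurable_agreeo]
    |apply: measurableI; [exact: measurable_agree|exact: measurable_agreeo]|]; last first.
  apply/seteqP; split=> u //= -[[/agree_rcons[_ h1] _] [/agree_rcons[_ h2] _]].
  by rewrite h1 in h2.
apply: (etrans (f_equal2 _ (IH' true) (IH' false))).
by rewrite -EFinD -mulrDl -mulrDr /q addrCA subrr addr0 mulr1.
Qed.

(* Under [bernoulli_product] the coordinates are independent and equal to
   [true] with probability [p]; this determines the measure. *)
Lemma bernoulli_productE (s : seq T) (c : T -> bool) : uniq s ->
  bernoulli_product [set w | forall t, t \in s -> w t = c t] =
  (\prod_(t <- s) (if c t then p else 1 - p))%:E.
Proof.
move=> us.
pose a i : option bool := if pickle_inv i is Some t then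
  if t \in s then Some (c t) else None else None.
have aP t : t \in s -> a (pickle t) = Some (c t).
  by move=> ts; rewrite /a pickleK_inv ts.
pose n := (\max_(t <- s) (pickle t).+1)%N.
have sn t : t \in s -> (pickle t < n)%N.
  by move=> ts; rewrite /n (big_rem t)//= leq_maxl.
have -> : bernoulli_product [set w | forall t, t \in s -> w t = c t] =
    U ([set u | agree [::] u] `&` [set u | agreeo a 0 (0 + n) u]).
  congr (U _); apply/seteqP; split=> u /=.
    move=> h; split=> // i _ b; rewrite /a.
    case E : (pickle_inv i) => [t|//]; case: ifP => // ts [<-].
    by rewrite -(h t ts) /bcode; have := pickle_invK (T := T) i; rewrite E /= => ->.
  by move=> [_ h] t ts; apply: h; [rewrite add0n sn|exact: aP].
rewrite (uniform_agree a [::] n) big_nil mul1r add0n; congr (_%:E).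
transitivity (\prod_(i <- [seq pickle t | t <- s]) qo (a i)).
  rewrite /index_iota subn0 (bigID (mem [seq pickle t | t <- s]))/=.
  rewrite [X in _ * X]big1 ?mulr1; last first.
    move=> i ns; rewrite /a; case E : (pickle_inv i) => [t|//].
    case: ifP => // ts; move/negP: ns; case; apply/mapP; exists t => //.
    by have := pickle_invK (T := T) i; rewrite E.
  rewrite -big_filter; apply: perm_big; apply: uniq_perm.
  - by rewrite filter_uniq// iota_uniq.
  - by rewrite map_inj_uniq//; exact: (pcan_inj pickleK).
  - move=> i; rewrite mem_filter mem_iota add0n leq0n/=.
    by apply/andP/idP => [[]//|ims]; split=> //; case/mapP: ims => t /sn + ->.
by rewrite big_map; apply: eq_big_seq => t ts; rewrite aP.
Qed.

End BernoulliProduct.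

(* A configuration gives a state to every pair of natural numbers; a pair
   {u, v} is encoded as [(minn u v, maxn u v)]. For a graph [G] only the states
   of the edges of [G] matter, and these are independent, open with
   probability [p]. *)
Definition perc (R : realType) (p : R) :
    probability (config (nat * nat)%type) R :=
  bernoulli_product (nat * nat)%type p.

Section Percolation.
Variables (G : egraph) (w : config (nat * nat)%type).

Definition open_adj : rel nat :=
  fun u v => adj G u v && w (minn u v, maxn u v).

Definition cluster (u : nat) : set nat := [set v | linked open_adj u v].

Definition infinite_clusters : set (set nat) :=
  [set C | infinite_set C /\ exists2 u, vert G u & C = cluster u].

Definition num_infinite_clusters (R : realType) : \bar R :=
  counting infinite_clusters.

Definition root_percolates : Prop :=
  infinite_set (cluster (root G).1) \/ infinite_set (cluster (root G).2).

End Percolation.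

(* These quantities are invariant under isomorphism, hence do not depend on
   the representative [egrepr x]. *)
Definition theta (R : realType) (x : egspace R) (p : R) : \bar R :=
  perc p [set w | root_percolates (egrepr x) w].

Definition pcrit (R : realType) (x : egspace R) : R :=
  sup [set p | 0 <= p <= 1 /\ theta x p = 0%E].

(* Main.v *)
Require Import Defs.
From HB Require Import structures.
From Stdlib Require Ring.
From mathcomp Require finmap.
From mathcomp Require Import all_boot all_order all_algebra.
From mathcomp Require Import all_classical all_reals all_analysis.

Set Implicit Arguments.
Unset Strict Implicit.
Unset Printing Implicit Defensive.

Import Order.TTheory GRing.Theory Num.Theory.
Import numFieldNormedType.Exports.

Local Open Scope classical_set_scope.
Local Open Scope ring_scope.

(** At every scale [k], an edge of the limit graph lies in a copy of the
    hierarchical graph of level [k] which is attached to the rest of the graph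
    only by its two terminals: a block ([eblock]). Replacing each copy of [G1] by
    a single edge, declared open when the copy is crossed by an open path, turns
    Bernoulli percolation of parameter [p] at one level into Bernoulli
    percolation of parameter [f p] at the coarser level ([Ex_coarsen]), where
    [f = crossing G1]. So a block of scale [k] joins its terminals with
    probability [iter k f p] ([Pr_crosses_hier]).

    The iteration of [f] is governed by two facts. The Moore-Shannon inequality
    ([Pr_odds]) says that [f] does not decrease odds ratios, so its graph crosses
    the diagonal at most once, from below ([crossing_gt]). Two edge-disjoint paths
    give [1 - f q <= C * (1 - q) ^+ 2] ([crossing_quadratic]); hence [f] is not the
    identity, and convergence of the iterates to 1 is summable ([crossing_tail]).
    Given [q < p], either the iterates of [q] tend to 0 or those of [p] tend to 1
    ([iter_crossing_dichotomy]).

    If the iterates of [q] tend to 0 the root does not percolate: at infinitely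
    many scales [k] the root is in a block of scale [k + m] at a coarse position
    away from the terminals, and to leave this block an open path has to cross one
    of boundedly many blocks of scale [k] ([no_percolation]). Hence for [p] above
    the critical value the iterates of [p] tend to 1 ([above_pcrit]). Two distinct
    infinite clusters would both contain a terminal of every large block, and
    so no large block would be crossed: this has probability 0
    ([disjoint_infinite0]). Conversely, climbing from a scale [K] to larger and
    larger ones, all the sub-blocks met on the way are crossed with
    probability close to 1 when [K] is large, by summability, and then a fixed
    neighbourhood of the root is joined to infinity ([reaches_ge],
    [some_infinite1]).

    All this holds for a fixed graph that is [structured], that is, in which the
    root lies deep inside blocks of arbitrarily large scale. Almost every limit
    graph is: in the finite graphs, the positions of a uniform edge at
    successive scales are independent and uniform, so a prescribed position is
    very likely to occur in a long window of scales ([card_no_spot]); this event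
    is decided by a ball around the root and so passes to the limit
    ([window_ge], [ae_structured]). Prescribed positions at arbitrary
    distance from the terminals exist because the terminals of [G1] are not
    adjacent ([grandchild], [far_edge]). *)

(** * Open edges of a finite oriented graph *)

Section OpenEdges.
Variable H : ograph.
Implicit Types (w : {ffun edge H -> bool}) (e : edge H) (u v : H).

Lemma edge_eq e e' : (val e).1 = (val e').1 -> (val e).2 = (val e').2 -> e = e'.
Proof.
move=> h1 h2; apply: val_inj.
by rewrite [LHS]surjective_pairing [RHS]surjective_pairing h1 h2.
Qed.

Definition joins e u v : bool := (val e == (u, v)) || (val e == (v, u)).

Definition oadj w : rel H := fun u v => [exists e, w e && joins e u v].

Lemma joins_sym e u v : joins e u v = joins e v u.
Proof. by rewrite /joins orbC. Qed.

Lemma oadj_sym w : symmetric (oadj w).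
Proof. by move=> u v; apply: eq_existsb => e; rewrite joins_sym. Qed.

Lemma oconnect_sym w : connect_sym (oadj w).
Proof. exact: sym_connect_sym (oadj_sym w). Qed.

Lemma joins_uadj e u v : joins e u v -> uadj u v.
Proof. by rewrite /uadj; case/orP=> /eqP E; have := valP e; rewrite E => ->; rewrite ?orbT. Qed.

Lemma uadj_joins u v : uadj u v -> exists e, joins e u v.
Proof.
case/orP => h; [exists (Sub (u, v) h)|exists (Sub (v, u) h)];
by rewrite /joins SubK eqxx ?orbT.
Qed.

Lemma uadj_sym : symmetric (@uadj H).
Proof. by move=> u v; rewrite /uadj orbC. Qed.

Lemma joins_ends e : joins e (val e).1 (val e).2.
Proof. by rewrite /joins -surjective_pairing eqxx. Qed.

Definition crosses w : bool := connect (oadj w) (src H) (tgt H).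

Lemma oadj_connected w : (forall e, w e) -> forall u v, connect (oadj w) u v.
Proof.
move=> all_open u v; have := ograph_conn u v; apply: connect_sub => x y xy.
apply: connect1; have [e exy] := uadj_joins xy.
by apply/existsP; exists e; rewrite all_open.
Qed.

Lemma oconnect_closed w u v : (forall e, ~~ w e) -> connect (oadj w) u v -> u = v.
Proof.
move=> closed /connectP[[|x s] //= /andP[/existsP[e /andP[we _]] _] _].
by rewrite (negbTE (closed e)) in we.
Qed.

End OpenEdges.

(** * Edges of a replacement and coarsening of configurations *)

Section Coarsening.
Variables H G : ograph.
Local Notation HG := (replace H G).
Implicit Types (e : edge H) (f : edge G) (x y : H) (w : {ffun edge HG -> bool}).

Lemma child_subproof e f :
  oedge HG (copy e (val f).1, copy e (val f).2).1 (copy e (val f).1, copy e (val f).2).2.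
Proof.
apply/existsP; exists e; apply/existsP; exists (val f).1; apply/existsP.
by exists (val f).2; rewrite (valP f) !eqxx.
Qed.

Definition child e f : edge HG :=
  Sub (copy e (val f).1, copy e (val f).2) (child_subproof e f).

Lemma val_child e f : val (child e f) = (copy e (val f).1, copy e (val f).2).
Proof. by []. Qed.

Lemma child_surj (d : edge HG) : exists ef : edge H * edge G, d = child ef.1 ef.2.
Proof.
have /existsP[e /existsP[u /existsP[v /and3P[uv /eqP d1 /eqP d2]]]] := valP d.
exists (e, Sub (u, v) uv); apply: val_inj.
by rewrite val_child /= [LHS]surjective_pairing d1 d2.
Qed.

Lemma copy_eq e e' (u u' : G) : copy e u = copy e' u' -> e = e' \/
  (u \in [:: src G; tgt G]) && (u' \in [:: src G; tgt G]).
Proof.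
case: (copyP u) => [->|->|[z ->]]; case: (copyP u') => [->|->|[z' ->]];
rewrite ?copy_src ?copy_tgt ?copy_inner ?inE ?eqxx ?orbT; try by right.
all: by move=> // -[-> _]; left.
Qed.

(** Two copies have only old vertices in common, so an edge lying in both would
    join the two terminals of [G], and the edges that they replace would have
    the same ends. *)
Lemma child_inj e e' f f' : child e f = child e' f' -> e = e' /\ f = f'.
Proof.
move=> /(congr1 val); rewrite !val_child => -[c1 c2].
have ee' : e = e'.
  have [//|/andP[]] := copy_eq c1; have [//|/andP[]] := copy_eq c2.
  have := valP f; have := valP f'.
  have irr (K : ograph) (x : K) : oedge K x x = false.
    by apply/negP => h; have := oedge_asym h; rewrite h.
  move: c1 c2; rewrite !inE => c1 c2 h' h.
  move=> /orP[]/eqP E2 /orP[]/eqP E2' /orP[]/eqP E1 /orP[]/eqP E1';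
  move: c1 c2 h h'; rewrite E1 E2 E1' E2' ?irr// ?copy_src ?copy_tgt.
  - move=> [F1] [F2] _ _.
    exact: edge_eq.
  - by move=> _ _ h /(fun h' => oedge_asym h'); rewrite h.
  - by move=> _ _ h /(fun h' => oedge_asym h'); rewrite h.
  - move=> [F1] [F2] _ _.
    exact: edge_eq.
split=> //; move: c1 c2; rewrite ee' => /copy_inj F1 /copy_inj F2.
exact: edge_eq.
Qed.

Definition split_edge (d : edge HG) : edge H * edge G := projT1 (cid (child_surj d)).

Definition parent d := (split_edge d).1.
Definition digit d := (split_edge d).2.

Lemma split_edgeK d : child (parent d) (digit d) = d.
Proof. by rewrite /parent /digit /split_edge; case: cid. Qed.

Lemma parent_child e f : parent (child e f) = e.
Proof. by have [] := child_inj (split_edgeK (child e f)). Qed.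

Lemma digit_child e f : digit (child e f) = f.
Proof. by have [] := child_inj (split_edgeK (child e f)). Qed.

Definition restriction w e : {ffun edge G -> bool} := [ffun f => w (child e f)].

(** One renormalization step: a copy is seen as a single edge, open when the
    copy joins its two ends. *)
Definition coarsen w : {ffun edge H -> bool} := [ffun e => crosses (restriction w e)].

Lemma joins_child e f (u v : G) : joins f u v -> joins (child e f) (copy e u) (copy e v).
Proof.
by rewrite /joins val_child; case/orP=> /eqP ->; rewrite eqxx ?orbT.
Qed.

Lemma joins_replace (d : edge HG) z z' : joins d z z' ->
  exists e f u v, [/\ d = child e f, z = copy e u, z' = copy e v & joins f u v].
Proof.
rewrite -(split_edgeK d); set e := parent d; set f := digit d.
rewrite {1}/joins val_child; case/orP => /eqP[<- <-]; exists e, f.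
  by exists (val f).1, (val f).2; split=> //; exact: joins_ends.
by exists (val f).2, (val f).1; split=> //; rewrite joins_sym; exact: joins_ends.
Qed.

Lemma uadj_replace z z' : @uadj HG z z' ->
  exists e (u v : G), [/\ z = copy e u, z' = copy e v & uadj u v].
Proof.
move=> /uadj_joins[d /joins_replace[e [f [u [v [_ -> -> h]]]]]].
by exists e, u, v; split=> //; exact: joins_uadj h.
Qed.

Lemma uadj_copy e u v : uadj u v -> @uadj HG (copy e u) (copy e v).
Proof. by move=> /uadj_joins[f /(joins_child e)/joins_uadj]. Qed.

Lemma connect_copy w e (u v : G) : connect (oadj (restriction w e)) u v ->
  connect (oadj w) (copy e u) (copy e v).
Proof.
move=> /connectP[s ps ->]; elim: s u ps => //= x s IH u /andP[ux /IH].
apply: connect_trans; apply: connect1.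
have /existsP[f /andP[]] := ux; rewrite ffunE => wf j.
by apply/existsP; exists (child e f); rewrite wf joins_child.
Qed.

(** A path started at an old vertex [x] enters a copy through one of its two
    ends, and it can pass from one end to the other only by crossing the copy. *)
Lemma reach_copy w x e (v : G) : connect (oadj w) (inl x : HG) (copy e v) ->
  connect (oadj (coarsen w)) x (val e).1 && connect (oadj (restriction w e)) (src G) v ||
  connect (oadj (coarsen w)) x (val e).2 && connect (oadj (restriction w e)) (tgt G) v.
Proof.
pose J e v :=
  connect (oadj (coarsen w)) x (val e).1 && connect (oadj (restriction w e)) (src G) v ||
  connect (oadj (coarsen w)) x (val e).2 && connect (oadj (restriction w e)) (tgt G) v.
have proj1 e1 : coarsen w e1 -> connect (oadj (coarsen w)) (val e1).1 (val e1).2.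
  by move=> h; apply: connect1; apply/existsP; exists e1; rewrite h joins_ends.
have Jsrc e1 : J e1 (src G) = connect (oadj (coarsen w)) x (val e1).1.
  rewrite /J connect0 andbT; apply/orb_idr => /andP[xe2 cr].
  apply: connect_trans xe2 _; rewrite oconnect_sym; apply: proj1.
  by rewrite ffunE /crosses oconnect_sym.
have Jtgt e1 : J e1 (tgt G) = connect (oadj (coarsen w)) x (val e1).2.
  rewrite /J connect0 andbT; apply/orb_idl => /andP[xe2 cr].
  by apply: connect_trans xe2 _; apply: proj1; rewrite ffunE.
pose I (z : HG) := match z with
  | inl y => connect (oadj (coarsen w)) x y | inr (e1, v1) => J e1 (val v1) end.
have IJ e1 v1 : I (copy e1 v1) = J e1 v1.
  case: (copyP v1) => [->|->|[v2 ->]]; last by rewrite copy_inner.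
    by rewrite copy_src Jsrc.
  by rewrite copy_tgt Jtgt.
rewrite -/(J e v) -IJ; move: (copy e v) => z /connectP[s ps ->].
have : I (inl x) by exact: connect0.
elim: s (inl x : HG) ps => //= z1 s IH z0 /andP[/existsP[d /andP[wd]]].
move=> /joins_replace[e1 [f [u1 [v1 [dE -> -> j]]]]] ps.
rewrite IJ => J0; apply: IH ps _; rewrite IJ.
have step t : connect (oadj (restriction w e1)) t u1 -> connect (oadj (restriction w e1)) t v1.
  move=> h; apply: connect_trans h _; apply: connect1.
  by apply/existsP; exists f; rewrite ffunE -dE wd.
by case/orP: J0 => /andP[h1 h2]; apply/orP; [left|right]; rewrite h1 step.
Qed.

Lemma copy_inl x : exists e (v : G), (inl x : HG) = copy e v.
Proof.
have [y xy] : exists y, uadj x y.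
  have nst := src_neq_tgt H.
  have [y nxy] : exists y, x != y.
    by have [->|] := eqVneq x (src H); [exists (tgt H)|exists (src H)].
  have /connectP[[|z s] /= ps ly] := ograph_conn x y.
    by rewrite ly eqxx in nxy.
  by exists z; case/andP: ps.
case/orP: xy => h.
  by exists (Sub (x, y) h), (src G); rewrite copy_src.
by exists (Sub (y, x) h), (tgt G); rewrite copy_tgt.
Qed.

Lemma connect_coarsen w x y :
  connect (oadj w) (inl x : HG) (inl y) = connect (oadj (coarsen w)) x y.
Proof.
apply/idP/idP => [|/connectP[s ps ->]].
  have [e [v Ey]] := copy_inl y; rewrite Ey => /reach_copy.
  have end_eq : v = src G /\ y = (val e).1 \/ v = tgt G /\ y = (val e).2.
    move: Ey; case: (copyP v) => [->|->|[z ->]].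
    - by rewrite copy_src => -[->]; left.
    - by rewrite copy_tgt => -[->]; right.
    - by rewrite copy_inner.
  have cross : crosses (restriction w e) -> connect (oadj (coarsen w)) (val e).1 (val e).2.
    move=> h; apply: connect1; apply/existsP; exists e.
    by rewrite joins_ends ffunE h.
  case: end_eq => -[-> ->] /orP[] /andP[h1 h2] //.
    apply: connect_trans h1 _; rewrite oconnect_sym; apply: cross.
    by rewrite /crosses oconnect_sym.
  by apply: connect_trans h1 _; apply: cross.
elim: s x ps => //= z s IH x /andP[/existsP[e /andP[we j]] ps].
apply: connect_trans (IH z ps); move: we; rewrite ffunE => /connect_copy.
rewrite copy_src copy_tgt => h.
by case/orP: j => /eqP E; move: h; rewrite E // oconnect_sym.
Qed.

Lemma reach_parent w e (v : G) y : connect (oadj w) (copy e v) (inl y : HG) ->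
  connect (oadj (coarsen w)) (val e).1 y || connect (oadj (coarsen w)) (val e).2 y.
Proof.
rewrite oconnect_sym => /reach_copy.
by case/orP => /andP[]; rewrite oconnect_sym => ->; rewrite ?orbT.
Qed.

End Coarsening.

(** * Embedded blocks *)

Section Blocks.

(** The last condition makes the two terminals the only gates between the copy
    and the rest of the graph. *)
Record oblock (H H' : ograph) := OBlock {
  oblock_fun :> H -> H';
  oblock_inj : injective oblock_fun;
  oblock_edge : forall u v, oedge H u v -> oedge H' (oblock_fun u) (oblock_fun v);
  oblock_inner : forall u x, u != src H -> u != tgt H ->
    uadj (oblock_fun u) x -> exists2 v, x = oblock_fun v & uadj u v }.

Definition emap (H H' : ograph) (phi : oblock H H') (e : edge H) : edge H' :=
  Sub (phi (val e).1, phi (val e).2) (oblock_edge phi (valP e)).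

Section Lift.
Variables (H H' G : ograph) (phi : oblock H H').

Definition lift_fun (z : replace H G) : replace H' G :=
  match z with inl x => inl (phi x) | inr (e, v) => inr (emap phi e, v) end.

Lemma lift_copy e v : lift_fun (copy e v) = copy (emap phi e) v.
Proof.
by case: (copyP v) => [->|->|[w ->]];
rewrite ?copy_src ?copy_tgt ?copy_inner.
Qed.

Lemma lift_inj : injective lift_fun.
Proof.
case=> [x|[e v]] [y|[e' v']] //=.
  by move=> [/(@oblock_inj _ _ phi) ->].
by move=> [/(@oblock_inj _ _ phi) h1 /(@oblock_inj _ _ phi) h2 ->]; rewrite (edge_eq h1 h2).
Qed.

Lemma lift_edge u v : oedge (replace H G) u v ->
  oedge (replace H' G) (lift_fun u) (lift_fun v).
Proof.
move=> /existsP[e /existsP[x /existsP[y /and3P[xy /eqP -> /eqP ->]]]].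
by apply/existsP; exists (emap phi e); apply/existsP; exists x;
  apply/existsP; exists y; rewrite xy !lift_copy !eqxx.
Qed.

Lemma lift_inner u x : u != src (replace H G) -> u != tgt (replace H G) ->
  uadj (lift_fun u) x -> exists2 v, x = lift_fun v & uadj u v.
Proof.
move=> us ut /uadj_replace[e' [a [b [ua -> ab]]]].
suff [e e'E ->] : exists2 e, e' = emap phi e & u = copy e a.
  by exists (copy e b); [rewrite lift_copy e'E|exact: uadj_copy].
case: u us ut ua => [u us0 ut0 /= ua|[e v] _ _ /=].
  have us : u != src H by apply: contra us0 => /eqP ->.
  have ut : u != tgt H by apply: contra ut0 => /eqP ->.
  have [e e'E] : exists e, e' = emap phi e.
    have inc : (val e').1 = phi u \/ (val e').2 = phi u.
      move: ua; case: (copyP a) => [->|->|[z ->]].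
      - by rewrite copy_src => -[->]; left.
      - by rewrite copy_tgt => -[->]; right.
      - by rewrite copy_inner.
    have adj' : uadj (val e').1 (val e').2 by rewrite /uadj (valP e').
    have back p q : oedge H' (phi p) (phi q) -> uadj p q -> oedge H p q.
      move=> h /orP[//|/(oblock_edge phi)/oedge_asym].
      by rewrite h.
    case: inc => inc.
      move: adj'; rewrite inc => /(oblock_inner us ut)[v e2 uv].
      have h : oedge H u v by apply: back => //; rewrite -inc -e2; exact: (valP e').
      exists (Sub (u, v) h); apply: val_inj.
      by rewrite /= [LHS]surjective_pairing inc e2.
    move: adj'; rewrite uadj_sym inc => /(oblock_inner us ut)[v e2 uv].
    have h : oedge H v u.
      by apply: back; rewrite 1?uadj_sym// -inc -e2; exact: (valP e').
    exists (Sub (v, u) h); apply: val_inj.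
    by rewrite /= [LHS]surjective_pairing inc e2.
  exists e => //; apply: lift_inj; rewrite lift_copy -e'E //.
case: (copyP a) => [->|->|[z ->]]; rewrite ?copy_src ?copy_tgt ?copy_inner//.
by move=> [<- ->]; exists e; rewrite ?copy_inner.
Qed.

(** Replacement acts on embeddings, so a block at one scale yields blocks at all
    finer scales. *)
Definition lift_block : oblock (replace H G) (replace H' G) :=
  OBlock lift_inj lift_edge lift_inner.

Lemma emap_lift e f : emap lift_block (child e f) = child (emap phi e) f.
Proof. by apply: val_inj; rewrite /= !lift_copy. Qed.

End Lift.

Section EdgeBlock.
Variables (H : ograph) (e : edge H).

Definition edge_fun (b : single_edge) : H := if b then (val e).2 else (val e).1.

Lemma edge_fun_inj : injective edge_fun.
Proof.
by case=> -[] //= /eqP; rewrite ?(negbTE (edge_neq e))// eq_sym (negbTE (edge_neq e)).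
Qed.

Lemma edge_fun_edge u v : oedge single_edge u v -> oedge H (edge_fun u) (edge_fun v).
Proof. by case: u; case: v => //= _; exact: (valP e). Qed.

Lemma edge_fun_inner u x : u != src single_edge -> u != tgt single_edge ->
  uadj (edge_fun u) x -> exists2 v, x = edge_fun v & uadj u v.
Proof. by case: u. Qed.

Definition edge_block : oblock single_edge H :=
  OBlock edge_fun_inj edge_fun_edge edge_fun_inner.

End EdgeBlock.

Definition the_edge : edge single_edge := Sub (false, true) isT.

Lemma the_edgeE (e : edge single_edge) : e = the_edge.
Proof. by apply: val_inj; move: (valP e) => /=; case: (val e) => -[] []. Qed.

Lemma emap_edge_block (H : ograph) (e : edge H) : emap (edge_block e) the_edge = e.
Proof. by apply: val_inj; rewrite /= -surjective_pairing. Qed.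

End Blocks.

Section Hierarchy.
Variable G : ograph.
Local Notation hG := (hier G).

(** Levels are written [k + i] in all that follows: addition is by recursion on
    its first argument, so the graph of level [k.+1 + i] unfolds to a
    replacement and no transport between equal levels is needed. *)
Fixpoint ancestor k i : edge (hG (k + i)) -> edge (hG i) :=
  match k return edge (hG (k + i)) -> edge (hG i) with
  | 0 => id
  | k'.+1 => fun e => ancestor (parent (e : edge (replace (hG (k' + i)) G)))
  end.

Fixpoint coarsen_iter k i : {ffun edge (hG (k + i)) -> bool} -> {ffun edge (hG i) -> bool} :=
  match k return {ffun edge (hG (k + i)) -> bool} -> {ffun edge (hG i) -> bool} with
  | 0 => id
  | k'.+1 => fun w =>
    coarsen_iter (coarsen (w : {ffun edge (replace (hG (k' + i)) G) -> bool}))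
  end.

Fixpoint old_vertex k i : hG i -> hG (k + i) :=
  match k return hG i -> hG (k + i) with
  | 0 => id
  | k'.+1 => fun x => (inl (@old_vertex k' i x) : replace (hG (k' + i)) G)
  end.

Fixpoint block_at m i (e : edge (hG i)) : oblock (hG m) (hG (m + i)) :=
  match m return oblock (hG m) (hG (m + i)) with
  | 0 => edge_block e
  | m'.+1 => lift_block G (@block_at m' i e)
  end.

(** Where an edge sits in the block of scale [m] that contains it; together with
    the ancestor this determines the edge, by [block_at_position]. *)
Fixpoint position m i : edge (hG (m + i)) -> edge (hG m) :=
  match m return edge (hG (m + i)) -> edge (hG m) with
  | 0 => fun=> the_edge
  | m'.+1 => fun e => let d := (e : edge (replace (hG (m' + i)) G)) in
    (child (position (parent d)) (digit d) : edge (replace (hG m') G))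
  end.

Lemma block_at_position m i (e : edge (hG (m + i))) :
  emap (block_at m (ancestor e)) (position e) = e.
Proof.
elim: m i e => [|m IH] i e /=; first exact: emap_edge_block.
by rewrite emap_lift IH split_edgeK.
Qed.

Lemma connect_coarsen_iter k i (w : {ffun edge (hG (k + i)) -> bool}) x y :
  connect (oadj w) (old_vertex k x) (old_vertex k y) = connect (oadj (coarsen_iter w)) x y.
Proof. by elim: k w => //= k IH w; rewrite connect_coarsen IH. Qed.

Lemma old_vertex_src k i : old_vertex k (src (hG i)) = src (hG (k + i)).
Proof. by elim: k => //= k ->. Qed.

Lemma old_vertex_tgt k i : old_vertex k (tgt (hG i)) = tgt (hG (k + i)).
Proof. by elim: k => //= k ->. Qed.

Lemma reach_ancestor k i (w : {ffun edge (hG (k + i)) -> bool}) (e : edge (hG (k + i))) x y :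
  x = (val e).1 \/ x = (val e).2 -> connect (oadj w) x (old_vertex k y) ->
  connect (oadj (coarsen_iter w)) (val (ancestor e)).1 y ||
  connect (oadj (coarsen_iter w)) (val (ancestor e)).2 y.
Proof.
elim: k w e x => [|k IH] w e x /=; first by case=> -> ->; rewrite ?orbT.
set d := (e : edge (replace (hG (k + i)) G)) => xe.
have {xe}[v ->] : exists v, x = copy (parent d) v.
  rewrite -(split_edgeK d) val_child in xe.
  by case: xe => ->; eexists.
move=> /reach_parent/orP[h|h]; apply: IH h; [by left|by right].
Qed.

End Hierarchy.

(** * Edges far from the terminals *)

Section Far.

(** Families of sets that grow at least as fast as balls. *)
Definition spread (H : ograph) (P : nat -> H -> Prop) : Prop :=
  (forall s x, P s x -> P s.+1 x) /\
  (forall s x y, P s x -> uadj x y -> P s.+1 y).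

Definition near (H : ograph) (e : edge H) (s : nat) (y : H) : Prop :=
  exists2 n, (n <= s)%N & walk (@uadj H) (val e).1 y n \/ walk (@uadj H) (val e).2 y n.

Definition far (H : ograph) (r : nat) (e : edge H) : Prop :=
  forall y, near e r y -> y != src H /\ y != tgt H.

Lemma rcons_uwalk (H : ograph) (x y z : H) n :
  walk (@uadj H) x y n -> uadj y z -> walk (@uadj H) x z n.+1.
Proof.
move=> [s [ps <- <-]] yz; exists (rcons s z).
by rewrite rcons_path ps yz last_rcons size_rcons.
Qed.

Lemma near_spread (H : ograph) (e : edge H) : spread (near e).
Proof.
split=> [s x [n ns w]|s x y [n ns w] xy]; first by exists n => //; exact: leqW.
by exists n.+1 => //; case: w => w; [left|right]; exact: rcons_uwalk xy.
Qed.

Lemma spread_walk (H : ograph) (P : nat -> H -> Prop) s x y n :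
  spread P -> P s x -> walk (@uadj H) x y n -> P (s + n)%N y.
Proof.
move=> [_ Pstep] + [t [+ <- <-]]; elim: t s x => [|z t IH] s x /=.
  by rewrite addn0.
by move=> Px /andP[xz]; rewrite addnS -addSn; apply: IH; exact: Pstep xz.
Qed.

Lemma spread_le (H : ograph) (P : nat -> H -> Prop) s t x :
  spread P -> (s <= t)%N -> P s x -> P t x.
Proof.
move=> [Pmono _] /subnK <-; elim: (t - s)%N => //= n IH /IH; exact: Pmono.
Qed.

Lemma near_end1 (H : ograph) (e : edge H) s : near e s (val e).1.
Proof. by exists 0%N => //; left; exists [::]. Qed.

Lemma near_end2 (H : ograph) (e : edge H) s : near e s (val e).2.
Proof. by exists 0%N => //; right; exists [::]. Qed.

Section LiftSpread.
Variables (H G : ograph) (P : nat -> H -> Prop).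
Hypothesis Pspread : spread P.

(** Replacing the edges does not bring old vertices closer to each other. Rather
    than comparing lengths of paths, one lifts a family that grows like balls:
    a new vertex counts as reached once an end of its copy is. *)
Definition lift_near (s : nat) (z : replace H G) : Prop :=
  match z with inl x => P s x | inr (e, _) => P s (val e).1 \/ P s (val e).2 end.

Lemma lift_near_copy s e v : P s (val e).1 -> P s (val e).2 -> lift_near s (copy e v).
Proof.
move=> P1 P2; case: (copyP v) => [->|->|[w ->]];
rewrite ?copy_src ?copy_tgt ?copy_inner//=.
by left.
Qed.

Lemma lift_near_inner s e (v : G) : v != src G -> v != tgt G ->
  P s (val e).1 \/ P s (val e).2 -> lift_near s (copy e v).
Proof.
case: (copyP v) => [->|->|[w ->]]; rewrite ?eqxx//.
by rewrite copy_inner.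
Qed.

Lemma lift_near_ends s e (v : G) : lift_near s (copy e v) -> P s (val e).1 \/ P s (val e).2.
Proof.
case: (copyP v) => [->|->|[w ->]]; rewrite ?copy_src ?copy_tgt ?copy_inner//=;
by [left|right].
Qed.

Lemma lift_near_spread : spread lift_near.
Proof.
have [Pmono Pstep] := Pspread; split=> [s [x|[e v]] /=|s x y Px].
- exact: Pmono.
- by case=> /Pmono; [left|right].
- move=> /uadj_replace[e [u [v [xE -> _]]]].
  move: Px; rewrite xE => /lift_near_ends h.
  have ee : uadj (val e).1 (val e).2 by rewrite /uadj (valP e).
  apply: lift_near_copy; case: h => h.
  + exact: Pmono.
  + by apply: Pstep h _; rewrite uadj_sym.
  + exact: Pstep h _.
  + exact: Pmono.
Qed.

End LiftSpread.

Variable G : ograph.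

Lemma far_child (H : ograph) (e : edge H) (f : edge G) r : far r e -> far r (child e f).
Proof.
move=> fe y; suff h : near (child e f) r y -> lift_near (near e) r y.
  move=> /h; case: y h => [x _ /= /fe[xs xt]|[e1 v] _ _]; last by [].
  by split; apply/eqP => -[] E; [move: xs|move: xt]; rewrite E eqxx.
have sp := lift_near_spread G (near_spread e).
case=> n nr w; apply: (spread_le sp nr); rewrite -[n]add0n.
have start u : lift_near (near e) 0 (copy e u : replace H G).
  by apply: lift_near_copy; [exact: near_end1|exact: near_end2].
by case: w; apply: spread_walk => //; rewrite val_child; exact: start.
Qed.

Lemma far_ancestor r k i (e : edge (hier G (k + i))) : far r (ancestor e) -> far r e.
Proof.
elim: k e => //= k IH e /IH h.
by rewrite -(split_edgeK (e : edge (replace (hier G (k + i)) G))); exact: far_child.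
Qed.

Hypothesis dst : (1 < gdist (@uadj G) (src G) (tgt G))%N.

Lemma not_uadj_st : ~~ uadj (src G) (tgt G).
Proof.
apply: contraL dst => st; rewrite -leqNgt; apply: gdist_le.
by exists [:: tgt G] => /=; rewrite st.
Qed.

Definition terminals : seq G := [:: src G; tgt G].

Lemma not_uadj_terminals t u : t \in terminals -> u \in terminals -> ~~ uadj t u.
Proof.
have irr x : ~~ @uadj G x x.
  by rewrite /uadj orbb; apply/negP => h; have := oedge_asym h; rewrite h.
rewrite !inE => /orP[]/eqP-> /orP[]/eqP-> //; first exact: not_uadj_st.
by rewrite uadj_sym; exact: not_uadj_st.
Qed.

Lemma edge_at (t : G) : t \in terminals ->
  exists f : edge G, exists v : G, [/\ joins f t v, v != src G & v != tgt G].
Proof.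
move=> tst; have [y ty] : exists y, uadj t y.
  have [z tz] : exists z, z != t.
    have := src_neq_tgt G.
    by have [->|] := eqVneq (src G) t; [exists (tgt G); rewrite eq_sym|exists (src G)].
  have /connectP[[|y s] /= ps lz] := ograph_conn t z.
    by rewrite lz eqxx in tz.
  by exists y; case/andP: ps.
have [f tfy] := uadj_joins ty; exists f, y.
by split=> //; apply: contraTneq ty => ->; apply: not_uadj_terminals => //;
  rewrite !inE eqxx ?orbT.
Qed.

(** The terminals of [G] are not adjacent, so an edge at one of them has its
    other end at an inner vertex. Choosing twice such an edge, first in the copy
    replacing [e] and then in the copy replacing the chosen edge, one gets an
    edge none of whose ends is an end of [e]. Leaving the large copy then costs
    one more step. *)
Lemma grandchild (H : ograph) (e : edge H) :
  exists d : edge (replace (replace H G) G),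
    [/\ forall y, near d 0 y -> y != src (replace (replace H G) G) /\
          y != tgt (replace (replace H G) G) &
        forall r, far r e -> far r.+1 d].
Proof.
have [|f1 [v [j1 vs vt]]] := @edge_at (src G); first by rewrite inE eqxx.
pose e1 : edge (replace H G) := child e f1.
have [t [tst e1t]] : exists t, t \in terminals /\ copy e1 t = inl (copy e v).
  case/orP: j1 => /eqP Ef; [exists (tgt G)|exists (src G)];
    by rewrite !inE eqxx ?orbT ?copy_tgt ?copy_src val_child Ef.
have [f2 [w [j2 ws wt]]] := edge_at tst.
pose d : edge (replace (replace H G) G) := child e1 f2.
have e1w z : copy e1 w = inl z -> False.
  by move: ws wt; case: (copyP w) => [->|->|[w' ->]]; rewrite ?eqxx// copy_inner.
have ev z : copy e v = inl z -> False.
  by move: vs vt; case: (copyP v) => [->|->|[w' ->]]; rewrite ?eqxx// copy_inner.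
have dends x : x = (val d).1 \/ x = (val d).2 -> x = inl (copy e v) \/ x = copy e1 w.
  by rewrite val_child -e1t; case/orP: j2 => /eqP ->; case=> ->; by [left|right].
exists d.
have d0 x : x = (val d).1 \/ x = (val d).2 ->
    x != src (replace (replace H G) G) /\ x != tgt (replace (replace H G) G).
  move=> /dends[->|->]; split; apply/eqP => E; try exact: (e1w _ E).
    by case: E => E; exact: (ev _ E).
  by case: E => E; exact: (ev _ E).
split.
  move=> y [[|//] _ h]; apply: d0.
  by case: h => -[s [_ <- /size0nil ->]]; [left|right].
move=> r fe.
(* at time 0 the family [P2] already contains the neighbours of the ends of [d],
   so the first step comes for free *)
pose P2 := lift_near (G := G) (lift_near (G := G) (near e)).
have sp2 : spread P2 by do 2 apply: lift_near_spread; exact: near_spread.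
have cp2 u : P2 0%N (copy e1 u).
  apply: lift_near_copy; rewrite val_child; apply: lift_near_copy;
  by [exact: near_end1|exact: near_end2].
have P2first x y : x = (val d).1 \/ x = (val d).2 -> uadj x y -> P2 0%N y.
  move=> /dends[->|->] /uadj_replace[e2 [a [b [h -> ab]]]].
    have ast : a \in terminals.
      move: h; case: (copyP a) => [->|->|[a' ->]]; rewrite ?inE ?eqxx ?orbT//.
      by rewrite copy_inner.
    have [bs bt] : b != src G /\ b != tgt G.
      by split; apply: contraTneq ab => ->; apply: not_uadj_terminals => //;
        rewrite !inE eqxx ?orbT.
    apply: lift_near_inner => //.
    have Pv : lift_near (near e) 0 (copy e v : replace H G).
      by apply: lift_near_copy; [exact: near_end1|exact: near_end2].
    move: h ast; rewrite !inE => h /orP[] /eqP Ea; move: h;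
      rewrite Ea ?copy_src ?copy_tgt => -[<-]; by [left|right].
  have [<-|] := copy_eq h; first exact: cp2.
  by rewrite !inE (negbTE ws) (negbTE wt).
move=> y [[|n] nr wlk].
  have yd : y = (val d).1 \/ y = (val d).2.
    by case: wlk => -[s [_ <- /size0nil ->]]; [left|right].
  exact: d0.
have {wlk}Py : P2 r y.
  apply: (spread_le sp2 (nr : n <= r)%N); rewrite -[n]add0n.
  have step x : x = (val d).1 \/ x = (val d).2 -> walk (@uadj _) x y n.+1 ->
      P2 (0 + n)%N y.
    move=> xd [s]; case: s => [[]//|z s [/= /andP[dz ps] ls [ss]]].
    by apply: (spread_walk sp2 (P2first _ _ xd dz)); exists s.
  by case: wlk; apply: step; [left|right].
case: y Py => [[x /= Px|[e2 u] _]|[e2 u] _] //.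
have [xs xt] := fe x Px.
by split; apply/eqP => -[] E; [move: xs|move: xt]; rewrite E eqxx.
Qed.

Lemma far_edge r : exists m (e : edge (hier G m)), far r e.
Proof.
elim: r => [|r [m [e fe]]].
  have [d [d0 _]] := @grandchild (hier G 0) the_edge.
  by exists 2%N, d => y [[|//] _ w]; apply: d0; exists 0%N.
have [d [_ /(_ r fe) fd]] := grandchild e.
by exists m.+2, d.
Qed.

End Far.

(** * Bernoulli configurations on a finite set *)

Section FiniteBernoulli.
Variables (S : comNzRingType) (T : finType).
Implicit Types (q : S) (w : {ffun T -> bool}) (g : {ffun T -> bool} -> S).

Definition wt q (b : bool) : S := if b then q else 1 - q.

Definition weight q w : S := \prod_t wt q (w t).

Definition Ex q g : S := \sum_w g w * weight q w.

Definition Pr q (A : pred {ffun T -> bool}) : S := Ex q (fun w => (A w)%:R).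

Lemma wtD q : wt q true + wt q false = 1.
Proof. by rewrite /wt addrCA subrr addr0. Qed.

Lemma sum_weight q : \sum_w weight q w = 1.
Proof.
rewrite /weight -(bigA_distr_bigA (fun _ : T => wt q)) /=.
by apply: big1 => t _; rewrite big_bool; exact: wtD.
Qed.

Lemma eq_Ex q g g' : g =1 g' -> Ex q g = Ex q g'.
Proof. by move=> gg'; apply: eq_bigr => w _; rewrite gg'. Qed.

Lemma eq_Pr q (A B : pred {ffun T -> bool}) : A =1 B -> Pr q A = Pr q B.
Proof. by move=> AB; apply: eq_Ex => w; rewrite AB. Qed.

Lemma Ex_cst q c : Ex q (fun=> c) = c.
Proof. by rewrite /Ex -big_distrr /= sum_weight mulr1. Qed.

Lemma PrC q (A : pred {ffun T -> bool}) : Pr q (fun w => ~~ A w) = 1 - Pr q A.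
Proof.
rewrite -(sum_weight q) /Pr /Ex -sumrB; apply: eq_bigr => w _.
by case: (A w); rewrite /= ?mul0r ?mul1r ?subrr ?subr0.
Qed.

Lemma PrE q (A : pred {ffun T -> bool}) : Pr q A = \sum_(w | A w) weight q w.
Proof.
rewrite /Pr /Ex [RHS]big_mkcond; apply: eq_bigr => w _.
by case: (A w); rewrite ?mul1r ?mul0r.
Qed.

Definition upd w t b : {ffun T -> bool} := [ffun s => if s == t then b else w s].

Lemma upd_id w t : upd w t (w t) = w.
Proof. by apply/ffunP => s; rewrite ffunE; case: eqVneq => [->|]. Qed.

Lemma upd_upd w t b c : upd (upd w t b) t c = upd w t c.
Proof. by apply/ffunP => s; rewrite !ffunE; case: eqVneq. Qed.

Lemma upd_at w t b : upd w t b t = b.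
Proof. by rewrite ffunE eqxx. Qed.

Definition resample q t g w : S := q * g (upd w t true) + (1 - q) * g (upd w t false).

Lemma weight_upd q w t b :
  weight q (upd w t b) = wt q b * \prod_(s | s != t) wt q (w s).
Proof.
rewrite /weight (bigD1 t) //= upd_at; congr (_ * _).
by apply: eq_bigr => s /negbTE st; rewrite ffunE st.
Qed.

Definition flip t w := upd w t (~~ w t).

Lemma flipK t : involutive (flip t).
Proof. by move=> w; rewrite /flip upd_at upd_upd negbK upd_id. Qed.

(** Pairing each configuration with the one flipped at [t] averages over the
    state of [t]; every pair is counted twice, hence the doubled left-hand
    side. *)
Lemma Ex_flip q t g :
  Ex q g + Ex q g = \sum_w resample q t g w * \prod_(s | s != t) wt q (w s).
Proof.
rewrite {2}/Ex (reindex_inj (can_inj (flipK t))) -big_split /=.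
apply: eq_bigr => w _; pose F v := g v * weight q v.
transitivity (F (upd w t (w t)) + F (upd w t (~~ w t))); first by rewrite upd_id.
rewrite /F !weight_upd /resample /wt mulrDl -!mulrA.
by case: (w t) => /=; rewrite [X in X + _]mulrCA [X in _ + X]mulrCA // addrC.
Qed.

Lemma Pr1 q : Pr q predT = 1.
Proof. exact: Ex_cst. Qed.

Lemma Pr_at q t : Pr q (fun w => w t) = q.
Proof.
rewrite PrE /weight.
have -> : \sum_(w : {ffun T -> bool} | w t) \prod_s wt q (w s) =
    \sum_(w in family (fun s b => (s == t) ==> b)) \prod_s wt q (w s).
  apply: eq_bigl => w; apply/idP/familyP => [wt1 s|/(_ t)]; last first.
    by rewrite unfold_in eqxx.
  by rewrite unfold_in; apply/implyP => /eqP ->.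
rewrite -(bigA_distr_big_dep (fun s b => (s == t) ==> b) (fun _ : T => wt q)).
rewrite (bigD1 t) //= [X in _ * X]big1 => [|s /negbTE st].
  by rewrite big_mkcond big_bool /= eqxx /= addr0 mulr1.
by rewrite big_mkcond big_bool /= st; exact: wtD.
Qed.

End FiniteBernoulli.

Section RealBernoulli.
Variables (R : realDomainType) (T : finType) (q : R).
Hypothesis q01 : 0 <= q <= 1.
Implicit Types (A B : pred {ffun T -> bool}).

Lemma wt_ge0 b : 0 <= wt q b.
Proof. by have /andP[q0 q1] := q01; case: b => //=; rewrite subr_ge0. Qed.

Lemma weight_ge0 (w : {ffun T -> bool}) : 0 <= weight q w.
Proof. by apply: prodr_ge0 => t _; exact: wt_ge0. Qed.

Lemma Pr_ge0 A : 0 <= Pr q A.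
Proof. by rewrite PrE; apply: sumr_ge0 => w _; exact: weight_ge0. Qed.

Lemma le_Pr A B : (forall w, A w -> B w) -> Pr q A <= Pr q B.
Proof.
move=> AB; apply: ler_sum => w _; apply: ler_wpM2r; first exact: weight_ge0.
by rewrite ler_nat; case: (A w) (AB w) => // ->.
Qed.

Lemma Pr_le1 A : Pr q A <= 1.
Proof. by rewrite -(Pr1 T q); apply: le_Pr. Qed.

Lemma Pr_union (I : finType) (P : pred I) (A : I -> pred {ffun T -> bool}) :
  Pr q (fun w => [exists i, P i && A i w]) <= \sum_(i | P i) Pr q (A i).
Proof.
rewrite /Pr /Ex exchange_big /=; apply: ler_sum => w _.
rewrite -mulr_suml; apply: ler_wpM2r; first exact: weight_ge0.
case: existsP => [[i /andP[Pi Ai]]|_]; last by apply: sumr_ge0.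
by rewrite (bigD1 i) //= Ai lerDl; apply: sumr_ge0.
Qed.

Lemma PrU A B : Pr q (fun w => A w || B w) <= Pr q A + Pr q B.
Proof.
rewrite /Pr /Ex -big_split /=; apply: ler_sum => w _.
rewrite -mulrDl; apply: ler_wpM2r; first exact: weight_ge0.
by rewrite -natrD ler_nat; case: (A w); case: (B w).
Qed.

End RealBernoulli.

Lemma Pr_closed2 (R : realDomainType) (T : finType) (q : R) (s t : T) :
  0 <= q <= 1 -> s != t ->
  Pr q (fun w : {ffun T -> bool} => ~~ w s && ~~ w t) = (1 - q) ^+ 2.
Proof.
move=> q01 st; rewrite PrE /weight.
pose Q u b := ((u == s) || (u == t)) ==> ~~ b.
have -> : \sum_(w : {ffun T -> bool} | ~~ w s && ~~ w t) \prod_u wt q (w u) =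
    \sum_(w in family Q) \prod_u wt q (w u).
  apply: eq_bigl => w; apply/andP/familyP => [[ws wt1] u|h].
    by rewrite unfold_in; apply/implyP => /orP[]/eqP->.
  by have := h s; have := h t; rewrite !unfold_in /Q !eqxx orbT /= => -> ->.
rewrite -(bigA_distr_big_dep Q (fun _ : T => wt q)).
have closed u : (u == s) || (u == t) -> \sum_(b | Q u b) wt q b = 1 - q.
  by move=> ust; rewrite (big_pred1 false) // => b; rewrite /Q ust; case: b.
rewrite (bigD1 s) //= (bigD1 t) 1?eq_sym //= [X in _ * (_ * X)]big1.
  by rewrite !closed ?eqxx ?orbT // mulr1 expr2.
move=> u /andP[/negbTE us /negbTE ut].
by rewrite big_mkcond big_bool /Q us ut /=; exact: wtD.
Qed.

(** * Coarse-graining a Bernoulli configuration *)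

(** The copies are disjoint, so the events that they are crossed are
    independent: coarsening a Bernoulli configuration gives another one. *)
Section CoarsenLaw.
Variables (S : comNzRingType) (H G : ograph).

Definition crossing (K : ograph) (q : S) : S := Pr q (@crosses K).

Lemma Ex_coarsen (q : S) (g : {ffun edge H -> bool} -> S) :
  Ex q (fun w : {ffun edge (replace H G) -> bool} => g (coarsen w)) =
  Ex (crossing G q) g.
Proof.
pose W (w : {ffun edge G -> bool}) : S := weight q w.
pose split (w : {ffun edge (replace H G) -> bool}) :
  {ffun edge H -> {ffun edge G -> bool}} := [ffun e => restriction w e].
pose glue (W : {ffun edge H -> {ffun edge G -> bool}}) :
  {ffun edge (replace H G) -> bool} := [ffun d => W (parent d) (digit d)].
have splitK : cancel split glue.
  by move=> w; apply/ffunP => d; rewrite !ffunE split_edgeK.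
have glueK : cancel glue split.
  move=> V; apply/ffunP => e; rewrite ffunE; apply/ffunP => f.
  by rewrite !ffunE parent_child digit_child.
have childK : cancel (fun d : edge (replace H G) => (parent d, digit d))
    (fun ef => child ef.1 ef.2) by move=> d; exact: split_edgeK.
have child_K : cancel (fun ef : edge H * edge G => child ef.1 ef.2)
    (fun d => (parent d, digit d)).
  by case=> e f; rewrite /= parent_child digit_child.
rewrite /Ex (reindex glue) /=; last by exists split => w _; rewrite ?splitK ?glueK.
pose cr (V : {ffun edge H -> {ffun edge G -> bool}}) : {ffun edge H -> bool} :=
  [ffun e => crosses (V e)].
have crE V : coarsen (glue V) = cr V.
  apply/ffunP => e; rewrite !ffunE; congr crosses.
  by apply/ffunP => f; rewrite !ffunE parent_child digit_child.
have wE V : weight q (glue V) = \prod_e W (V e).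
  rewrite /weight (reindex (fun ef : edge H * edge G => child ef.1 ef.2)) /=; last first.
    by exists (fun d => (parent d, digit d)) => d _; rewrite ?childK ?child_K.
  rewrite pair_big /=; apply: eq_bigr => -[e f] _.
  by rewrite ffunE parent_child digit_child.
under eq_bigr do rewrite crE wE.
rewrite (partition_big cr predT) //=; apply: eq_bigr => h _.
under eq_bigr => V /eqP -> do [].
rewrite -big_distrr /=; congr (_ * _).
have -> : \sum_(V : {ffun edge H -> {ffun edge G -> bool}} | cr V == h) \prod_e W (V e) =
    \sum_(V in family (fun e v => crosses v == h e)) \prod_e W (V e).
  apply: eq_bigl => V; apply/eqP/familyP => [<- e|hV].
    by rewrite unfold_in ffunE.
  by apply/ffunP => e; have := hV e; rewrite unfold_in ffunE => /eqP.
rewrite -(bigA_distr_big_dep (fun e v => crosses v == h e) (fun _ => W)) /=.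
apply: eq_bigr => e _; case: (h e); rewrite /wt /crossing -?PrC PrE;
  by apply: eq_bigl => v; case: (crosses v).
Qed.

End CoarsenLaw.

(** * The S-shape of the crossing probability *)

(** Stated for a ring given by its bare operations, the form in which [ring]
    applies. *)
Section RingIdentity.
Import Stdlib.setoid_ring.Ring_tac Stdlib.setoid_ring.Ring_theory.
Variables (T : Type) (zero one : T) (add mul : T -> T -> T) (opp : T -> T).
Hypothesis Tring : ring_theory zero one add mul (fun x y => add x (opp y)) opp eq.
Add Ring TRing : Tring.
Local Notation "x + y" := (add x y).
Local Notation "x * y" := (mul x y).
Local Notation "x - y" := (add x (opp y)).

Lemma odds_identity A B x y :
  let s := x * (one - y) in
  let DA := s + A * (y - x) in
  let DB := s + B * (y - x) in
  let F := x * A + (one - x) * B in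
  (y * A * DB + (one - y) * B * DA) * (s + F * (y - x)) =
  F * DA * DB +
    (A - B) * (y - x) * s * ((one - A) * s + B * (y - x + s)).
Proof. move=> s DA DB F; rewrite /DA /DB /F /s; ring. Qed.

End RingIdentity.

Lemma comNzRing_theory (S : comNzRingType) :
  Ring_theory.ring_theory (0 : S) 1 +%R *%R (fun x y => x - y) -%R eq.
Proof.
split; [exact: add0r|exact:addrC|exact:addrA|exact:mul1r|exact:mulrC|exact:mulrA
  |exact:mulrDl| by []|exact:subrr].
Qed.

Section Inequality.
Variable R : realFieldType.
Implicit Types A B x y : R.

(** The inductive step for the odds inequality, where [A] and [B] are the
    probabilities at [x] given that one more site is open or closed, and [A'],
    [B'] those at [y]. After clearing denominators the two sides differ by
    [A - B] times a nonnegative quantity, see [odds_identity]. *)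
Lemma odds_step (A B A' B' x y : R) : 0 <= B -> B <= A -> A <= 1 ->
  0 < x -> x < y -> y < 1 ->
  A * (y * (1 - x)) <= A' * (x * (1 - y) + A * (y - x)) ->
  B * (y * (1 - x)) <= B' * (x * (1 - y) + B * (y - x)) ->
  (x * A + (1 - x) * B) * (y * (1 - x)) <=
  (y * A' + (1 - y) * B') * (x * (1 - y) + (x * A + (1 - x) * B) * (y - x)).
Proof.
move=> B0 BA A1 x0 xy y1 hA hB.
have := odds_identity (comNzRing_theory R) A B x y; rewrite /=.
set s := x * (1 - y); set t := y * (1 - x).
set DA := s + A * (y - x); set DB := s + B * (y - x).
set F := x * A + (1 - x) * B; set DF := s + F * (y - x) => id.
have s0 : 0 < s by rewrite mulr_gt0 // subr_gt0.
have d0 : 0 <= y - x by rewrite subr_ge0 ltW.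
have y0 := lt_trans x0 xy; have x1 := lt_trans xy y1.
have t0 : 0 <= t by rewrite mulr_ge0 ?subr_ge0 // ltW.
have A0 := le_trans B0 BA; have B1 := le_trans BA A1.
have F0 : 0 <= F by rewrite addr_ge0 // mulr_ge0 ?subr_ge0 // ltW.
have DA0 : 0 < DA by rewrite ltr_wpDr // mulr_ge0.
have DB0 : 0 < DB by rewrite ltr_wpDr // mulr_ge0.
have DF0 : 0 < DF by rewrite ltr_wpDr // mulr_ge0.
rewrite -(ler_pM2r (mulr_gt0 DA0 DB0)).
apply: (@le_trans _ _ ((y * A * DB + (1 - y) * B * DA) * DF * t)).
  rewrite id [leLHS]mulrAC [F * (DA * DB)]mulrA; apply: ler_wpM2r => //.
  have s0' := ltW s0; have := BA; have := A1.
  rewrite lerDl -[A <= 1]subr_ge0 -[B <= A]subr_ge0 => A1' BA'.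
  have h1 : 0 <= (A - B) * (y - x) * s by apply: mulr_ge0 => //; exact: mulr_ge0.
  have h2 : 0 <= B * (y - x + s) by apply: mulr_ge0 => //; exact: addr_ge0.
  by apply: mulr_ge0 => //; apply: addr_ge0 => //; exact: mulr_ge0.
rewrite mulrAC [leRHS]mulrAC; apply: ler_wpM2r; first exact: ltW.
rewrite [(y * A' + _) * _]mulrDl [(y * A * DB + _) * _]mulrDl; apply: lerD.
  rewrite [DA * DB]mulrC [leRHS]mulrACA [y * A * DB]mulrAC -[leLHS]mulrA.
  by apply: ler_wpM2l => //; rewrite mulr_ge0 // ltW.
rewrite [leRHS]mulrACA [(1 - y) * B * DA]mulrAC -[leLHS]mulrA.
by apply: ler_wpM2l => //; rewrite mulr_ge0 ?subr_ge0 // ltW.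
Qed.

End Inequality.

Section Resampling.
Variables (R : realFieldType) (T : finType).
Implicit Types (w : {ffun T -> bool}) (g : {ffun T -> bool} -> R) (s : seq T).

Lemma Ex_resample (q : R) t g : Ex q (resample q t g) = Ex q g.
Proof.
have : Ex q (resample q t g) + Ex q (resample q t g) = Ex q g + Ex q g.
  rewrite !(Ex_flip q t); apply: eq_bigr => w _; congr (_ * _).
  by rewrite /resample !upd_upd -mulrDl addrCA subrr addr0 mul1r.
by move=> /eqP; rewrite -!mulr2n eqr_pMn2r // => /eqP.
Qed.

Fixpoint resamples (q : R) g s : {ffun T -> bool} -> R :=
  if s is t :: s' then resample q t (resamples q g s') else g.

Lemma Ex_resamples q g s : Ex q (resamples q g s) = Ex q g.
Proof. by elim: s => //= t s <-; rewrite Ex_resample. Qed.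

Lemma resamples_agree q g s w w' : (forall t, t \notin s -> w t = w' t) ->
  resamples q g s w = resamples q g s w'.
Proof.
elim: s w w' => [|t s IH] w w' h /=; first by congr g; apply/ffunP => t; exact: h.
have upd_h b : resamples q g s (upd w t b) = resamples q g s (upd w' t b).
  apply: IH => u us; rewrite !ffunE; case: eqVneq => // ut.
  by apply: h; rewrite inE negb_or ut.
by rewrite /resample !upd_h.
Qed.

(** Once all sites have been resampled the result is a constant. This computes
    an expectation one site at a time and so allows induction on the sites. *)
Lemma Ex_enum q g w : Ex q g = resamples q g (enum T) w.
Proof.
rewrite -(Ex_resamples q g (enum T)) -[RHS](Ex_cst T q); apply: eq_Ex => w'.
by apply: resamples_agree => t; rewrite mem_enum.
Qed.

Variable A : pred {ffun T -> bool}.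
Hypothesis A_up : forall w w', (forall t, w t -> w' t) -> A w -> A w'.
Let g w : R := (A w)%:R.

Lemma resamples_up q s w w' : 0 <= q <= 1 -> (forall t, w t -> w' t) ->
  0 <= resamples q g s w /\ resamples q g s w <= resamples q g s w' /\
  resamples q g s w' <= 1.
Proof.
move=> /andP[q0 q1]; elim: s w w' => [|t s IH] w w' ww' /=.
  rewrite /g ler0n ler_nat lern1; split=> //; split; last by case: (A w').
  by case: (A w) (A_up ww') => // ->.
have updw b : forall u, upd w t b u -> upd w' t b u.
  by move=> u; rewrite !ffunE; case: eqVneq => // _; exact: ww'.
have q1' : 0 <= 1 - q by rewrite subr_ge0.
have [a0 [a1 a2]] := IH _ _ (updw true); have [b0 [b1 b2]] := IH _ _ (updw false).
rewrite /resample; split; first by rewrite addr_ge0 // mulr_ge0.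
split; first by rewrite lerD // ler_wpM2l.
rewrite -[leRHS](wtD q) /wt; apply: lerD; by rewrite ler_piMr.
Qed.

(** The Moore-Shannon inequality with cleared denominators: between [x] and [y],
    the odds of an increasing event grow by at least the factor by which the
    odds of a single site grow. *)
Lemma resamples_odds x y s w : 0 < x -> x < y -> y < 1 ->
  resamples x g s w * (y * (1 - x)) <=
  resamples y g s w * (x * (1 - y) + resamples x g s w * (y - x)).
Proof.
move=> x0 xy y1; have x01 : 0 <= x <= 1 by rewrite !ltW // (lt_trans xy).
elim: s w => [|t s IH] w /=.
  rewrite /g; case: (A w); rewrite ?mul0r // !mul1r.
  by rewrite !mulrBr !mulr1 [x * y]mulrC [leRHS]addrC addrA subrK.
have up : forall u, upd w t false u -> upd w t true u.
  by move=> u; rewrite !ffunE; case: eqVneq.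
have [B0 [BA A1]] := resamples_up s x01 up.
exact: odds_step.
Qed.

Lemma Pr_odds (x y : R) : 0 < x -> x < y -> y < 1 ->
  Pr x A * (y * (1 - x)) <= Pr y A * (x * (1 - y) + Pr x A * (y - x)).
Proof. by move=> *; rewrite /Pr !(Ex_enum _ _ [ffun=> true]); exact: resamples_odds. Qed.

End Resampling.

Section Sharp.
Variables (R : realType) (G : ograph).
Local Notation f := (@crossing R G).

Lemma crosses_up (H : ograph) (w w' : {ffun edge H -> bool}) :
  (forall e, w e -> w' e) -> crosses w -> crosses w'.
Proof.
move=> ww'; apply: connect_sub => u v /existsP[e /andP[we j]].
by apply: connect1; apply/existsP; exists e; rewrite ww'.
Qed.

Lemma crossing_01 q : 0 <= q <= 1 -> 0 <= f q <= 1.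
Proof. by move=> q01; rewrite Pr_ge0 // Pr_le1. Qed.

(** As a polynomial, the crossing probability is continuous, and it cannot agree
    with the identity on an interval without being equal to it. *)
Lemma crossing_horner q : f q = (crossing G ('X : {poly R})).[q].
Proof.
rewrite /crossing !PrE horner_sum; apply: eq_bigr => w _.
rewrite /weight horner_prod; apply: eq_bigr => e _.
by case: (w e); rewrite /wt ?hornerD ?hornerN ?hornerX ?hornerC.
Qed.

Lemma crossing_continuous : continuous f.
Proof.
rewrite (_ : f = horner (crossing G ('X : {poly R}))); first exact: continuous_horner.
by apply/funext => q; exact: crossing_horner.
Qed.

(** Both conclusions come from comparing the odds ratio of [f x] and [f y] with
    that of [x] and [y]. *)
Lemma crossing_ge (x y : R) : 0 < x -> x < y -> y < 1 -> x <= f x ->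
  y <= f y /\ (f y = y -> f x = x).
Proof.
move=> x0 xy y1 xf.
have := Pr_odds (@crosses_up G) x0 xy y1; rewrite -/(f x) -/(f y).
set a := f x; set b := f y => odds.
have a01 : 0 <= a <= 1 by apply: crossing_01; rewrite !ltW // (lt_trans xy).
have y0 := lt_trans x0 xy; have a0 : 0 < a := lt_le_trans x0 xf.
have D0 : 0 < x * (1 - y) + a * (y - x).
  by rewrite addr_gt0 // mulr_gt0 // subr_gt0.
have key : b <= y -> a <= x.
  move=> bly; have := le_trans odds (ler_wpM2r (ltW D0) bly).
  rewrite [leLHS]mulrCA (ler_pM2l y0) -lerBlDr -mulrBr opprB addrA subrK.
  by rewrite ler_pM2r // subr_gt0.
split.
  rewrite leNgt; apply/negP => by_.
  have ax : a = x by apply/eqP; rewrite eq_le xf key // ltW.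
  have x1 : 0 < x * (1 - x) by rewrite mulr_gt0 // subr_gt0 (lt_trans xy).
  by move: odds; rewrite ax -mulrDr addrA subrK mulrCA (ler_pM2r x1) leNgt by_.
by move=> by_; apply/eqP; rewrite eq_le xf key // by_.
Qed.

Lemma Pr_some_open (T : finType) (q : R) : 0 <= q <= 1 ->
  Pr q (fun w : {ffun T -> bool} => [exists t, w t]) <= #|T|%:R * q.
Proof.
move=> q01; have := Pr_union q01 xpredT (fun t (w : {ffun T -> bool}) => w t).
rewrite (eq_bigr (fun=> q)) => [|t _]; last exact: Pr_at.
by rewrite sumr_const mulr_natl.
Qed.

Lemma crossing0 : f 0 = 0.
Proof.
have i01 : 0 <= (0 : R) <= 1 by rewrite lexx ler01.
apply/eqP; rewrite eq_le; have /andP[-> _] := crossing_01 i01; rewrite andbT.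
rewrite -[leRHS](mulr0 #|edge G|%:R); apply: le_trans (Pr_some_open _ i01).
apply: le_Pr => // w; apply: contraLR => /existsPn closed.
by apply/negP => /(oconnect_closed closed)/eqP; rewrite (negbTE (src_neq_tgt G)).
Qed.

Hypothesis edge_disjoint : two_edge_disjoint_paths (src G) (tgt G).

Lemma closed_on_path (w : {ffun edge G -> bool}) x s :
  path (@uadj G) x s -> ~~ connect (oadj w) x (last x s) ->
  exists2 e : edge G, ~~ w e & [set (val e).1; (val e).2]%SET \in uedges x s.
Proof.
elim: s x => [|y s IH] x /=; first by rewrite connect0.
move=> /andP[/uadj_joins[e j] ps] nc; case: (boolP (w e)) => we.
  have [|d wd ds] := IH y ps.
    apply: contra nc; apply: connect_trans; apply: connect1.
    by apply/existsP; exists e; rewrite we.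
  by exists d => //; rewrite inE ds orbT.
exists e => //; rewrite inE; case/orP: j => /eqP -> /=; rewrite ?eqxx //.
by rewrite finset.setUC eqxx.
Qed.

(** With no single edge separating the terminals, two closed edges are needed
    to disconnect them. *)
Lemma crossing_quadratic : exists C : nat, forall q : R, 0 <= q <= 1 ->
  1 - f q <= C%:R * (1 - q) ^+ 2.
Proof.
exists #|{: edge G * edge G}| => q q01.
have [s [t [[ps ls _] [pt lt _] disj]]] := edge_disjoint.
pose A (dd : edge G * edge G) (w : {ffun edge G -> bool}) := ~~ w dd.1 && ~~ w dd.2.
rewrite -PrC; apply: (@le_trans _ _ (\sum_(dd | dd.1 != dd.2) Pr q (A dd))).
  apply: le_trans (Pr_union q01 (fun dd : edge G * edge G => dd.1 != dd.2) A).
  apply: le_Pr => // w nc.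
  have [|d wd ds] := @closed_on_path w (src G) s ps; first by rewrite ls.
  have [|d' wd' dt] := @closed_on_path w (src G) t pt; first by rewrite lt.
  apply/existsP; exists (d, d'); rewrite /A /= wd wd' !andbT.
  apply: contra disj => /eqP E; apply/hasP; rewrite -E in dt.
  by exists [set (val d).1; (val d).2]%SET.
apply: (@le_trans _ _ (\sum_(dd : edge G * edge G | dd.1 != dd.2) (1 - q) ^+ 2)).
  by apply: ler_sum => dd ne; rewrite Pr_closed2.
rewrite sumr_const mulr_natl ler_wpMn2l ?exprn_even_ge0 //.
exact: max_card.
Qed.

Lemma crossing_neq_id : exists2 q : R, 0 < q < 1 & f q <> q.
Proof.
have [C fC] := crossing_quadratic.
have u0 : 0 < (C.+2%:R : R)^-1 by rewrite invr_gt0.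
have u1 : (C.+2%:R : R)^-1 < 1 by rewrite invf_lt1 // ltr1n.
(* here [C * (1 - q) ^+ 2 < 1 - q] *)
exists (1 - C.+2%:R^-1); first by rewrite subr_gt0 u1 gtrBl.
move=> E; have := fC (1 - C.+2%:R^-1); rewrite E subKr => h.
have /h : 0 <= 1 - (C.+2%:R : R)^-1 <= 1 by rewrite subr_ge0 ltW // gerBl ltW.
rewrite expr2 mulrA ler_pMl // ler_pdivlMr // mul1r ler_nat.
by rewrite ltnNge leqnSn.
Qed.

(** Equality at [y] would propagate to all of [[x, y]]; the crossing polynomial
    would then be the identity, against the quadratic bound near 1. *)
Lemma crossing_gt (x y : R) : 0 < x -> x < y -> y < 1 -> x <= f x -> y < f y.
Proof.
move=> x0 xy y1 xf; have [yf eqy] := crossing_ge x0 xy y1 xf.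
rewrite lt_neqAle yf andbT eq_sym; apply/eqP => fy.
have fz z : x < z -> z < y -> f z = z.
  move=> xz zy; have [zf _] := crossing_ge x0 xz (lt_trans zy y1) xf.
  by have [_] := crossing_ge (lt_trans x0 xz) zy y1 zf; apply.
pose P := crossing G ('X : {poly R}) - 'X.
have P0 : P = 0.
  apply/eqP; apply: contraT => Pn0.
  pose z i : R := x + (y - x) / i.+2%:R.
  have yx : 0 < y - x by rewrite subr_gt0.
  have zi : injective z.
    move=> i j /addrI /(mulfI (lt0r_neq0 yx)) /invr_inj /eqP.
    by rewrite eqr_nat => /eqP[].
  have := max_poly_roots Pn0 (rs := [seq z i | i <- iota 0 (size P)]).
  rewrite map_inj_uniq // iota_uniq size_map size_iota ltnn => -> //.
  apply/allP => _ /mapP[i _ ->]; rewrite /root /P hornerD hornerN hornerX.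
  rewrite -crossing_horner fz ?subrr //.
    by rewrite /z ltrDl divr_gt0.
  by rewrite /z -ltrBrDl ltr_pdivrMr // ltr_pMr // ltr1n.
have [q _] := crossing_neq_id; apply.
by apply/eqP; rewrite -subr_eq0 crossing_horner -[q in _ - q]hornerX -hornerN -hornerD
  -/P P0 horner0.
Qed.

Lemma iter_crossing_01 k q : 0 <= q <= 1 -> 0 <= iter k f q <= 1.
Proof. by move=> q01; elim: k => //= k; exact: crossing_01. Qed.

Lemma crossing1 : f 1 = 1.
Proof.
have [C fC] := crossing_quadratic; have := fC 1; rewrite subrr expr0n mulr0 => h.
have /andP[_ f1] := @crossing_01 1 (introT andP (conj ler01 (lexx 1))).
by apply/eqP; rewrite eq_le f1 -subr_le0 h // ler01 lexx.
Qed.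

Lemma iter_crossing_fixed q l : (fun k => iter k f q) @ \oo --> l -> f l = l.
Proof.
move=> h; have h1 : (fun k => f (iter k f q)) @ \oo --> f l.
  by apply: continuous_cvg => //; exact: crossing_continuous.
have h2 : (fun k => f (iter k f q)) @ \oo --> l.
  by move: h; rewrite -(cvg_shiftS (fun k => iter k f q)).
exact: cvg_unique h1 h2.
Qed.

Lemma iter_crossing_to1 (x p : R) : 0 < x -> x < p -> p <= 1 -> x <= f x ->
  (fun k => iter k f p) @ \oo --> (1 : R).
Proof.
move=> x0 xp p1 xf; set u := fun k => iter k f p.
have p01 : 0 <= p <= 1 by rewrite p1 ltW // (lt_trans x0).
have up q : x < q -> q <= 1 -> q <= f q.
  move=> xq; rewrite le_eqVlt => /predU1P[->|q1]; first by rewrite crossing1.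
  exact: ltW (crossing_gt x0 xq q1 xf).
have u01 k : 0 <= u k <= 1 by exact: iter_crossing_01.
have ux k : x < u k.
  elim: k => // k IH; apply: (lt_le_trans IH); apply: (up _ IH).
  by have /andP[] := u01 k.
have u_nd : nondecreasing_seq u.
  apply/nondecreasing_seqP => k; apply: up => //.
  by have /andP[] := u01 k.
have u_cvg : cvgn u.
  apply: nondecreasing_is_cvgn => //; exists 1 => _ [k _ <-].
  by have /andP[] := u01 k.
have pl : p <= limn u := nondecreasing_cvgn_le u_nd u_cvg 0.
have l1 : limn u <= 1.
  by apply: limr_le => //; near=> k; have /andP[] := u01 k.
have fl := iter_crossing_fixed u_cvg.
move: l1; rewrite le_eqVlt => /predU1P[l1|l1]; first by rewrite -l1.
by have := crossing_gt x0 (lt_le_trans xp pl) l1 xf; rewrite fl ltxx.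
Unshelve. all: by end_near. Qed.

(** If [f q < q] then no smaller point moves up, since by [crossing_gt] it would
    carry [q] along; so the iterates of [q] decrease to a fixed point smaller
    than [q], which can only be 0. Otherwise every point between [q] and 1 moves up. *)
Lemma iter_crossing_dichotomy (q p : R) : 0 < q -> q < p -> p <= 1 ->
  (fun k => iter k f q) @ \oo --> (0 : R) \/ (fun k => iter k f p) @ \oo --> (1 : R).
Proof.
move=> q0 qp p1; have q1 := lt_le_trans qp p1.
have [qf|fq] := leP q (f q); [right|left]; first exact: iter_crossing_to1 qf.
set u := fun k => iter k f q.
have u01 k : 0 <= u k <= 1 by apply: iter_crossing_01; rewrite !ltW.
have down r : 0 <= r -> r <= q -> f r <= r.
  move=> r0; rewrite le_eqVlt => /predU1P[->|rq]; first exact: ltW.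
  rewrite leNgt; apply/negP => rf.
  move: r0; rewrite le_eqVlt => /predU1P[r0|r0].
    by move: rf; rewrite -r0 crossing0 ltxx.
  by have := crossing_gt r0 rq q1 (ltW rf); rewrite ltNge (ltW fq).
have uq k : u k <= q.
  elim: k => // k IH; apply: (le_trans _ IH); apply: (down _ _ IH).
    by have /andP[] := u01 k.
have u_ni : nonincreasing_seq u.
  apply/nonincreasing_seqP => k; apply: down => //.
  by have /andP[] := u01 k.
have u_cvg : cvgn u.
  apply: nonincreasing_is_cvgn => //; exists 0 => _ [k _ <-].
  by have /andP[] := u01 k.
have lq : limn u <= f q := nonincreasing_cvgn_ge u_ni u_cvg 1.
have l0 : 0 <= limn u.
  by apply: limr_ge => //; near=> k; have /andP[] := u01 k.
have fl := iter_crossing_fixed u_cvg.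
move: l0; rewrite le_eqVlt => /predU1P[l0|l0]; first by rewrite [X in _ --> X]l0.
by have := crossing_gt l0 (le_lt_trans lq fq) q1; rewrite fl lexx ltNge (ltW fq) => /(_ isT).
Unshelve. all: by end_near. Qed.

End Sharp.

(** * Percolation events *)

Section PercolationEvents.
Variables (R : realType) (p : R).
Local Notation conf := (config (nat * nat)%type).

Lemma measurable_coord (i : nat * nat) (b : bool) : measurable [set w : conf | w i = b].
Proof.
have m : measurable [set w : conf | w i] by apply: sub_sigma_algebra; exists i.
case: b; first exact: m.
rewrite (_ : [set w : conf | w i = false] = ~` [set w : conf | w i]).
  exact: measurableC.
by apply/seteqP; split=> w /=; case: (w i).
Qed.

Section Pull.
Variables (T : finType) (key : T -> nat * nat).

Definition pull (w : conf) : {ffun T -> bool} := [ffun t => w (key t)].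

Lemma pull_cylinder h : [set w | pull w = h] = [set w | forall t, w (key t) = h t].
Proof.
apply/seteqP; split=> [w /= <- t|w /= wh]; first by rewrite ffunE.
by apply/ffunP => t; rewrite ffunE.
Qed.

Lemma measurable_pull1 h : measurable [set w | pull w = h].
Proof.
rewrite pull_cylinder (_ : [set w | _] = \bigcap_t [set w : conf | w (key t) = h t]).
  rewrite -[X in measurable X]setCK setC_bigcap; apply: measurableC.
  apply: fin_bigcup_measurable; first exact: finite_finset.
  by move=> t _; apply: measurableC; exact: measurable_coord.
by apply/seteqP; split=> w /= wh t; [move=> _; exact: wh|exact: (wh t I)].
Qed.

Lemma pull_bigcup (A : pred {ffun T -> bool}) :
  [set w | A (pull w)] = \bigcup_(h in [set h | A h]) [set w | pull w = h].
Proof.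
by apply/seteqP; split=> [w /= Aw|w /= [h Ah ->] //]; exists (pull w).
Qed.

Lemma measurable_pull (A : pred {ffun T -> bool}) : measurable [set w | A (pull w)].
Proof.
rewrite pull_bigcup; apply: fin_bigcup_measurable; first exact: finite_finset.
by move=> h _; exact: measurable_pull1.
Qed.

Hypothesis p01 : 0 <= p <= 1.
Hypothesis key_inj : injective key.

Lemma perc_pull1 h : perc p [set w | pull w = h] = (weight p h)%:E.
Proof.
pose c i := [exists t, (key t == i) && h t].
have cE t : c (key t) = h t.
  apply/existsP/idP => [[u /andP[/eqP/key_inj -> //]]|ht].
  by exists t; rewrite eqxx.
have us : uniq [seq key t | t <- enum T] by rewrite map_inj_uniq ?enum_uniq.
have -> : [set w | pull w = h] =
    [set w : conf | forall i, i \in [seq key t | t <- enum T] -> w i = c i].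
  rewrite pull_cylinder; apply/seteqP; split=> w /= wh.
    by move=> _ /mapP[t _ ->]; rewrite wh cE.
  by move=> t; rewrite wh ?cE // map_f // mem_enum.
rewrite /perc bernoulli_productE // big_map big_enum /= /weight.
by congr (_%:E); apply: eq_bigr => t _; rewrite cE.
Qed.

(** Probabilities of connection events in finite blocks are computed through
    this reduction to finite sums. *)
Lemma perc_pull (A : pred {ffun T -> bool}) :
  perc p [set w | A (pull w)] = (Pr p A)%:E.
Proof.
rewrite pull_bigcup measure_fin_bigcup /=; last first.
- by move=> h _; exact: measurable_pull1.
- by move=> h h' _ _ [w /= [<- <-]].
- exact: finite_finset.
transitivity (\sum_(h <- index_enum _ | A h) perc p [set w | pull w = h])%E.
  by rewrite (bigfs _ (index_enum_uniq _)) // => h _; rewrite mem_index_enum.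
by rewrite PrE -sumEFin; apply: eq_bigr => h _; exact: perc_pull1.
Qed.

End Pull.

End PercolationEvents.

Section ClusterEvents.
Variables (R : realType) (X : egraph).
Local Notation conf := (config (nat * nat)%type).
Implicit Types (w : conf) (u v n : nat).

(** There are countably many finite sequences of vertices, and the condition
    that a given one is an open path involves finitely many edges. *)
Lemma measurable_linked u v : measurable [set w : conf | linked (open_adj X w) u v].
Proof.
have mpath s : forall x, measurable [set w : conf | path (open_adj X w) x s].
  elim: s => [|y s IH] x /=.
    by rewrite (_ : [set _ | _] = setT) //; apply/seteqP; split.
  have [xy|xy] := boolP (adj X x y); last first.
    rewrite (_ : [set _ | _] = set0) //; apply/seteqP; split=> w //=.
    by rewrite /open_adj (negbTE xy).
  rewrite (_ : [set _ | _] =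
    [set w : conf | w (minn x y, maxn x y) = true] `&` [set w | path (open_adj X w) y s]).
    by apply: measurableI; [exact: measurable_coord|exact: IH].
  apply/seteqP; split=> w /=; rewrite /open_adj xy /=; first by move/andP.
  by move=> [-> ->].
rewrite (_ : [set _ | _] =
  \bigcup_(s in [set: seq nat]) [set w : conf | path (open_adj X w) u s /\ last u s = v]).
  apply: countable_bigcupT_measurable => [|s]; first exact: countableP.
  have [<-|ne] := eqVneq (last u s) v.
    rewrite (_ : [set _ | _] = [set w : conf | path (open_adj X w) u s]) //.
    by apply/seteqP; split=> w /= => [[]|].
  rewrite (_ : [set _ | _] = set0) //; apply/seteqP; split=> w //= [_ /eqP].
  by rewrite (negbTE ne).
by apply/seteqP; split=> w /= => [[s ?]|[s _ ?]]; exists s.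
Qed.

Lemma infinite_nat_unbounded (A : set nat) :
  infinite_set A <-> forall n, exists2 m, (n <= m)%N & A m.
Proof.
split=> [infA n|unb /finite_seqP[s As]].
  apply: contrapT => no; apply: infA; apply: (@sub_finite_set _ _ `I_n).
    by move=> m Am; rewrite /= ltnNge; apply/negP => nm; apply: no; exists m.
  exact: finite_II.
have [m mlt] := unb (\max_(x <- s) x).+1.
rewrite As /= => ms; move: mlt; rewrite ltnNge => /negP; apply.
by rewrite (big_rem m) //= leq_maxl.
Qed.

Definition percolates u : set conf := [set w | infinite_set (Defs.cluster X w u)].

Lemma measurable_percolates u : measurable (percolates u).
Proof.
rewrite (_ : percolates u = \bigcap_n \bigcup_(m in [set m | (n <= m)%N])
    [set w : conf | linked (open_adj X w) u m]).
  apply: bigcap_measurableType => n _; apply: bigcup_measurable => m _.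
  exact: measurable_linked.
apply/seteqP; split=> w; rewrite /percolates /= infinite_nat_unbounded.
  by move=> h n _; have [m nm um] := h n; exists m.
by move=> h n; have [m nm um] := h n I; exists m.
Qed.

Lemma open_adj_sym w : symmetric (open_adj X w).
Proof. by move=> u v; rewrite /open_adj adj_sym minnC maxnC. Qed.

Lemma linked_vert w u v : vert X u -> linked (open_adj X w) u v -> vert X v.
Proof.
move=> + [s [+ <-]]; elim: s u => //= x s IH u uX /andP[/andP[ux _]]; apply: IH.
by apply: (@adj_vert _ _ u); rewrite adj_sym.
Qed.

Lemma eq_cluster w u v : linked (open_adj X w) u v -> Defs.cluster X w u = Defs.cluster X w v.
Proof.
move=> uv; apply/seteqP; split=> x.
  apply: linked_trans; apply: linked_sym uv; exact: open_adj_sym.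
exact: linked_trans.
Qed.

Definition some_infinite : set conf :=
  \bigcup_(u in vert X) percolates u.

Definition disjoint_infinite u v : set conf :=
  [set w | percolates u w /\ percolates v w /\ ~ linked (open_adj X w) u v].

Lemma measurable_some_infinite : measurable some_infinite.
Proof. by apply: bigcup_measurable => u _; exact: measurable_percolates. Qed.

Lemma measurable_disjoint_infinite u v : measurable (disjoint_infinite u v).
Proof.
rewrite (_ : disjoint_infinite u v = percolates u `&` (percolates v `&`
    ~` [set w : conf | linked (open_adj X w) u v])) //.
apply: measurableI; first exact: measurable_percolates.
apply: measurableI; first exact: measurable_percolates.
by apply: measurableC; exact: measurable_linked.
Qed.

(** This form of the event is a countable combination of connection events,
    hence measurable, and separates existence from uniqueness. *)
Lemma num_infinite_clusters1 : [set w | num_infinite_clusters X w R = 1%E] =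
  some_infinite `\` \bigcup_(u in vert X) \bigcup_(v in vert X) disjoint_infinite u v.
Proof.
apply/seteqP; split=> [w /= | w [[u uX uinf] nodisj]].
  rewrite /num_infinite_clusters /counting; case: asboolP => // fin.
  move=> /eqP; rewrite eqe -[1]/(1%:R) eqr_nat => /finmap.cardfs1P[C CE].
  have {CE}CE : infinite_clusters X w = [set C].
    by rewrite -(fset_setK fin) CE; apply/seteqP; split=> D /=; rewrite inE => /eqP.
  have [Cinf [u uX Cu]] : infinite_clusters X w C by rewrite CE.
  split; first by exists u => //; rewrite /percolates /= -Cu.
  move=> [x xX [y yX [xinf [yinf]]]]; apply.
  have cl z : vert X z -> percolates z w -> Defs.cluster X w z = C.
    move=> zX zinf; have : infinite_clusters X w (Defs.cluster X w z).
      by split=> //; exists z.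
    by rewrite CE.
  have : Defs.cluster X w x y.
    by rewrite (cl x xX xinf) -(cl y yX yinf); exists [::].
  by [].
rewrite /= /num_infinite_clusters /counting.
have -> : infinite_clusters X w = [set Defs.cluster X w u].
  apply/seteqP; split=> [C [Cinf [v vX CE]]|C ->]; last by split=> //; exists u.
  rewrite CE; apply/esym/eq_cluster; apply: contrapT => nuv; apply: nodisj.
  by exists u => //; exists v => //; split=> //; split=> //; rewrite /percolates /= -CE.
case: asboolP => [_|[]]; first by rewrite fset_set1 finmap.cardfs1.
exact: finite_set1.
Qed.

End ClusterEvents.

(** * Blocks in an infinite graph *)

(** As [oblock], in a graph without orientation. *)
Record eblock (X : egraph) (H : ograph) := EBlock {
  eblock_fun :> H -> nat;
  eblock_inj : injective eblock_fun;
  eblock_edge : forall u v, oedge H u v -> adj X (eblock_fun u) (eblock_fun v);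
  eblock_inner : forall u n, u != src H -> u != tgt H ->
    adj X (eblock_fun u) n -> exists2 v, n = eblock_fun v & uadj u v }.

Section EBlock.
Variables (X : egraph) (H : ograph) (phi : eblock X H).
Local Notation conf := (config (nat * nat)%type).
Implicit Types (w : conf) (u v : H) (e : edge H).

Definition pair_key u v : nat * nat := (minn (phi u) (phi v), maxn (phi u) (phi v)).

Definition edge_key e : nat * nat := pair_key (val e).1 (val e).2.

Lemma edge_key_inj : injective edge_key.
Proof.
move=> e e' []; set a := phi (val e).1; set b := phi (val e).2.
set a' := phi (val e').1; set b' := phi (val e').2 => m1 m2.
have [[/(@eblock_inj _ _ phi) E1 /(@eblock_inj _ _ phi) E2]|
      [/(@eblock_inj _ _ phi) E1 /(@eblock_inj _ _ phi) E2]] :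
    (a = a' /\ b = b') \/ (a = b' /\ b = a').
- move: m1 m2; rewrite /minn /maxn.
  by case: (ltnP a b) => _; case: (ltnP a' b') => _ -> ->; [left|right|right|left].
- exact: edge_eq.
- have := oedge_asym (valP e); rewrite -[oedge _ _ _]/(oedge H _ _) E1 E2.
  by have := valP e'; rewrite /= => ->.
Qed.

Lemma eblock_adj u v : uadj u v -> adj X (phi u) (phi v).
Proof. by case/orP => /(eblock_edge phi) //; rewrite adj_sym. Qed.

Definition local_config w : {ffun edge H -> bool} := pull edge_key w.

Lemma oadj_open w u v : oadj (local_config w) u v = uadj u v && open_adj X w (phi u) (phi v).
Proof.
have keyE e : joins e u v -> edge_key e = pair_key u v.
  by case/orP => /eqP E; rewrite /edge_key E // /pair_key minnC maxnC.
apply/existsP/andP => [[e /andP[]]|[uv]].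
  rewrite ffunE => we j; have uv := joins_uadj j.
  by rewrite uv /open_adj eblock_adj // -[(_, _)]/(pair_key u v) -(keyE e).
have [e j] := uadj_joins uv; rewrite /open_adj => /andP[_ we].
by exists e; rewrite ffunE j (keyE e) ?andbT.
Qed.

Lemma connect_linked w u v : connect (oadj (local_config w)) u v ->
  linked (open_adj X w) (phi u) (phi v).
Proof.
move=> /connectP[s ps ->]; exists (map phi s); split; last by rewrite last_map.
elim: s u ps => //= x s IH u /andP[+ /IH ->].
by rewrite oadj_open => /andP[_ ->].
Qed.

(** A vertex that is not a terminal has all its neighbours in the block, so an
    open path stays in the block until it meets a terminal. *)
Lemma exit_block w u n : linked (open_adj X w) (phi u) n ->
  [\/ exists v, n = phi v, connect (oadj (local_config w)) u (src H) |
      connect (oadj (local_config w)) u (tgt H)].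
Proof.
move=> [s [+ <-]]; elim: s u => [|x s IH] u /=; first by constructor 1; exists u.
have [->|us] := eqVneq u (src H); first by constructor 2; exact: connect0.
have [->|ut] := eqVneq u (tgt H); first by constructor 3; exact: connect0.
move=> /andP[ux]; have /andP[aux _] := ux.
have [v xv uv] := eblock_inner us ut aux; rewrite xv => ps.
have step t : connect (oadj (local_config w)) v t -> connect (oadj (local_config w)) u t.
  by apply: connect_trans; apply: connect1; rewrite oadj_open uv -xv.
have [h|h|h] := IH v ps; first by constructor 1.
  by constructor 2; exact: step.
by constructor 3; exact: step.
Qed.

Lemma percolates_exit w u : percolates X (phi u) w ->
  connect (oadj (local_config w)) u (src H) || connect (oadj (local_config w)) u (tgt H).
Proof.
move=> uinf; apply/orP; apply: contrapT => /not_orP[ns nt]; apply: uinf.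
apply: (@sub_finite_set _ _ (range phi)); last exact: finite_image.
by move=> n /exit_block[[v ->]|//|//]; exists v.
Qed.

Lemma eblock_walk u v n : walk (@uadj H) u v n -> walk (adj X) (phi u) (phi v) n.
Proof.
move=> [s [ps <- <-]]; exists (map phi s).
rewrite last_map size_map; split=> //.
by elim: s u ps => //= x s IH u /andP[/eblock_adj -> /IH].
Qed.

Definition at_root e : Prop :=
  Defs.root X = (phi (val e).1, phi (val e).2) \/ Defs.root X = (phi (val e).2, phi (val e).1).

Lemma near_gball e r v : at_root e -> near e r v -> gball X r (phi v).
Proof.
move=> re [n nr w]; apply/gballP; exists n => //.
by case: re => ->; case: w => /eblock_walk; [left|right|right|left].
Qed.

Lemma gball_near e r n : at_root e -> far r e -> gball X r n ->
  exists2 v, n = phi v & near e r v.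
Proof.
move=> re; elim: r n => [|r IH] n fe.
  have e1 := near_end1 e 0; have e2 := near_end2 e 0.
  move=> /gball0; case: re => -> /= [->|->];
    by [exists (val e).1|exists (val e).2].
have [mono step] := near_spread e.
have {}IH := fun n => IH n (fun y => fe y \o mono r y).
move=> /gballS[/IH[v -> nv]|[_ /IH[u -> nu] un]]; first by exists v => //; exact: mono.
have [us ut] := fe u (mono r u nu).
by have [v -> uv] := eblock_inner us ut un; exists v => //; exact: step nu uv.
Qed.

Lemma src_notin_gball e r : at_root e -> far r e -> ~ gball X r (phi (src H)).
Proof.
move=> re fe /(gball_near re fe)[v /(@eblock_inj _ _ phi) <- /fe[]].
by rewrite eqxx.
Qed.

End EBlock.

(** * Laws on the hierarchical graphs *)

Section HierarchyLaws.
Variables (R : realType) (G : ograph).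
Local Notation f := (@crossing R G).
Local Notation hG := (hier G).

Lemma Pr_coarsen_iter k i (q : R) (A : pred {ffun edge (hG i) -> bool}) :
  Pr q (fun w : {ffun edge (hG (k + i)) -> bool} => A (coarsen_iter w)) =
  Pr (iter k f q) A.
Proof.
elim: k q => // k IH q; rewrite iterSr -IH.
exact: (@Ex_coarsen _ (hG (k + i)) G q (fun w => (A (coarsen_iter w))%:R)).
Qed.

Lemma Pr_crosses_hier N (q : R) : Pr q (@crosses (hG N)) = iter N f q.
Proof.
elim: N q => [|N IH] q.
  rewrite -[RHS](@Pr_at R (edge single_edge) q the_edge); apply: eq_Pr => w.
  apply/idP/idP => [|h].
    apply: contraLR => h; apply/negP => /oconnect_closed E.
    have /E : forall e : edge single_edge, ~~ w e by move=> e; rewrite (the_edgeE e).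
    by [].
  by apply: connect1; apply/existsP; exists the_edge; rewrite h.
rewrite iterSr -IH; apply: etrans (@Ex_coarsen _ (hG N) G q (fun w => (crosses w)%:R)).
by apply: eq_Pr => w; exact: connect_coarsen.
Qed.

(** Following an edge to its ancestors, each level is passed if all the edges
    of one copy of [G] are open, which fails with probability at most the
    number of edges of [G] times the probability that an edge is closed. *)
Lemma Pr_ancestors i (q : R) (e : edge (hG i)) : 0 <= q <= 1 ->
  Pr q (fun w => ~~ connect (oadj w) (val e).1 (src (hG i))) <=
  #|edge G|%:R * \sum_(j < i) (1 - iter j f q).
Proof.
elim: i q e => [|i IH] q e q01.
  rewrite big_ord0 mulr0 -[leRHS](@Ex_cst R (edge single_edge) q 0).
  apply: ler_sum => w _; apply: ler_wpM2r; first exact: weight_ge0.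
  by rewrite (the_edgeE e) connect0.
set d := (e : edge (replace (hG i) G)).
pose A (w : {ffun edge (replace (hG i) G) -> bool}) :=
  [exists g : edge G, true && ~~ w (child (parent d) g)].
pose B (w : {ffun edge (replace (hG i) G) -> bool}) :=
  ~~ connect (oadj (coarsen w)) (val (parent d)).1 (src (hG i)).
apply: (@le_trans _ _ (Pr q (fun w => A w || B w))).
  apply: le_Pr => // w; apply: contraR; rewrite negb_or /B negbK => /andP[nA].
  rewrite -connect_coarsen; apply: connect_trans.
  have op g : w (child (parent d) g).
    by apply: contraT => h; move/existsPn: nA => /(_ g); rewrite h.
  have dE : (val e).1 = copy (parent d) (val (digit d)).1.
    exact: (congr1 (fun c : edge (replace (hG i) G) => (val c).1) (esym (split_edgeK d))).
  rewrite dE -(copy_src G (parent d)); apply: connect_copy; apply: oadj_connected => g.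
  by rewrite ffunE; exact: op.
apply: le_trans (PrU q01 A B) _; rewrite big_ord_recl mulrDr; apply: lerD.
  apply: le_trans (Pr_union q01 xpredT
    (fun g (w : {ffun edge (replace (hG i) G) -> bool}) => ~~ w (child (parent d) g))) _.
  rewrite (eq_bigr (fun=> 1 - q)) => [|g _]; last by rewrite PrC Pr_at.
  by rewrite sumr_const mulr_natl.
rewrite /B (_ : Pr q _ = Pr (f q)
    (fun w => ~~ connect (oadj w) (val (parent d)).1 (src (hG i)))); last first.
  exact: (@Ex_coarsen _ (hG i) G q
    (fun w => (~~ connect (oadj w) (val (parent d)).1 (src (hG i)))%:R)).
apply: le_trans (IH _ _ (crossing_01 G q01)) _.
by rewrite ler_wpM2l // ler_sum // => j _; rewrite -iterSr.
Qed.

(** The radius [m] does not depend on the number [i] of coarser levels: it stays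
    fixed while the surrounding block grows. *)
Lemma near_old_vertex K : exists m, forall i (e : edge (hG (K + i))),
  near e m (old_vertex K (val (ancestor e)).1).
Proof.
elim: K => [|K [m IH]]; first by exists 0%N => i e; exact: near_end1.
have [D Dwalk] : exists D, forall (u v : G), exists2 n, (n <= D)%N & walk (@uadj G) u v n.
  exists (\max_(uv : G * G) gdist (@uadj G) uv.1 uv.2) => u v.
  exists (gdist (@uadj G) u v); first exact: (leq_bigmax (u, v)).
  apply: gdistP; have /connectP[s ps E] := ograph_conn u v.
  by exists s.
exists (D + (m * D))%N => i e.
set d := (e : edge (replace (hG (K + i)) G)).
have walk_copy (c : edge (hG (K + i))) u v n : walk (@uadj G) u v n ->
    walk (@uadj (replace (hG (K + i)) G)) (copy c u) (copy c v) n.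
  move=> [s [ps <- <-]]; exists (map (copy c) s); rewrite last_map size_map; split=> //.
  elim: s u ps => //= x s IHs u /andP[ux /IHs ->]; rewrite andbT.
  exact: uadj_copy.
have walk_cat (H : ograph) (x y z : H) a b : walk (@uadj H) x y a ->
    walk (@uadj H) y z b -> walk (@uadj H) x z (a + b)%N.
  move=> [s [ps <- <-]] [t [pt <- <-]]; exists (s ++ t).
  by rewrite cat_path ps pt last_cat size_cat.
have lift_walk x y n : walk (@uadj (hG (K + i))) x y n ->
    exists2 n', (n' <= n * D)%N &
      walk (@uadj (replace (hG (K + i)) G)) (inl x) (inl y) n'.
  move=> [s [ps <- <-]]; elim: s x ps => [|z s IHs] x /=.
    by exists 0%N => //; exists [::].
  move=> /andP[xz /IHs[n' n'D w']].
  have [b bD wb] : exists2 b, (b <= D)%N &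
      walk (@uadj (replace (hG (K + i)) G)) (inl x) (inl z) b.
    have [c /orP[]/eqP cE] := uadj_joins xz.
      have [b bD wb] := Dwalk (src G) (tgt G); exists b => //.
      by have := walk_copy c _ _ _ wb; rewrite copy_src copy_tgt cE.
    have [b bD wb] := Dwalk (tgt G) (src G); exists b => //.
    by have := walk_copy c _ _ _ wb; rewrite copy_src copy_tgt cE.
  exists (b + n')%N; first by rewrite mulSn leq_add.
  exact: walk_cat w'.
have [n nm w] := IH i (parent d).
have [x xd [a aD wa]] : exists2 x, x = (val (parent d)).1 \/ x = (val (parent d)).2 &
    exists2 a, (a <= n * D)%N & walk (@uadj (replace (hG (K + i)) G))
      (inl x) (old_vertex K.+1 (val (ancestor e)).1) a.
  by case: w => /lift_walk; [exists (val (parent d)).1; [left|]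
    |exists (val (parent d)).2; [right|]].
have [b bD wb] : exists2 b, (b <= D)%N & walk (@uadj (replace (hG (K + i)) G))
    (val d).1 (inl x) b.
  have -> : (val d).1 = copy (parent d) (val (digit d)).1.
    exact: (congr1 (fun c : edge (replace (hG (K + i)) G) => (val c).1)
      (esym (split_edgeK d))).
  case: xd => ->; [rewrite -copy_src|rewrite -copy_tgt].
    by have [b bD wb] := Dwalk (val (digit d)).1 (src G); exists b => //; exact: walk_copy.
  by have [b bD wb] := Dwalk (val (digit d)).1 (tgt G); exists b => //; exact: walk_copy.
exists (b + a)%N; last by left; exact: walk_cat wa.
by rewrite leq_add // (leq_trans aD) // leq_mul2r nm orbT.
Qed.

Hypothesis edge_disjoint : two_edge_disjoint_paths (src G) (tgt G).

(** The quadratic bound makes the closing probabilities at least halve at each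
    level once they are small, so they are summable. *)
Lemma crossing_tail (p : R) : 0 <= p <= 1 -> (fun k => iter k f p) @ \oo --> (1 : R) ->
  forall e : R, 0 < e ->
  exists K, forall i, \sum_(j < i) (1 - iter (j + K) f p) <= e.
Proof.
move=> p01 p1 e e0; have [C fC] := crossing_quadratic R edge_disjoint.
pose x k : R := 1 - iter k f p.
have x0 k : 0 <= x k.
  by rewrite subr_ge0; have /andP[] := iter_crossing_01 G k p01.
(* below the second bound the terms halve, and twice the first bound is [e] *)
pose d : R := Num.min (e / 2) (C.+1%:R^-1 / 2).
have d0 : 0 < d by rewrite lt_min !divr_gt0.
have [K xK] : exists K, x K <= d.
  move/cvgrPdist_le : p1 => /(_ _ d0)[K _ /(_ K (leqnn K))] /= h; exists K.
  exact: le_trans (ler_norm _) h.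
exists K; have halve k : x k <= d -> x k.+1 *+ 2 <= x k.
  move=> xd; have := fC _ (iter_crossing_01 G k p01); rewrite -/(x k) -/(x k.+1) => h.
  have : C%:R * x k *+ 2 <= 1.
    have /(ler_wpM2l (ler0n R C)) h' : x k <= C.+1%:R^-1 / 2.
      by apply: le_trans xd _; rewrite ge_min lexx orbT.
    rewrite -mulr_natr; apply: le_trans (ler_wpM2r _ h') _ => //.
    rewrite mulrA divfK ?pnatr_eq0 // ler_pdivrMr // mul1r ler_nat; exact: leqnSn.
  move=> h2; apply: (@le_trans _ _ ((C%:R * x k *+ 2) * x k)).
    by rewrite mulrnAl -mulrA -expr2 lerMn2r h orbT.
  by rewrite ler_piMl.
have small j : x (j + K)%N <= d.
  elim: j => // j IH; apply: (le_trans _ IH); apply: le_trans (halve _ IH).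
  by rewrite mulr2n lerDl.
(* by [halve], each term is at most the decrease of [x _ *+ 2] at this step *)
have sum i : \sum_(j < i) x (j + K)%N + x (i + K)%N *+ 2 <= x K *+ 2.
  elim: i => [|i IH]; first by rewrite big_ord0 add0r.
  apply: le_trans IH; rewrite big_ord_recr /= -addrA lerD2l mulr2n lerD2l.
  exact: halve.
move=> i; apply: (@le_trans _ _ (x K *+ 2)).
  by apply: le_trans (sum i); rewrite lerDl mulrn_wge0.
rewrite -mulr_natr -ler_pdivlMr //; apply: le_trans xK _.
by rewrite ge_min lexx.
Qed.

End HierarchyLaws.

(** * Percolation on a graph containing large blocks around its root *)

Section Structured.
Variables (R : realType) (G : ograph).
Local Notation f := (@crossing R G).
Local Notation hG := (hier G).
Local Notation conf := (config (nat * nat)%type).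

(** A block of scale [k + m] around the root, in which the position of the
    root at the coarse scale is the edge [e]. *)
Definition spot m (e : edge (hG m)) (k : nat) (X : egraph) : Prop :=
  exists (phi : eblock X (hG (k + m))) (d : edge (hG (k + m))),
    at_root phi d /\ ancestor d = e.

(** Around the root there are blocks of arbitrarily large scale with terminals
    at distance more than [r]. The distance is imposed on the coarse position
    [e] only, since [far_ancestor] passes it on to the finer scales. *)
Definition structured (X : egraph) : Prop :=
  forall r, exists m (e : edge (hG m)), far r e /\
    forall K, exists2 k, (K <= k)%N & spot e k X.

Lemma le_perc (p : R) (A B : set conf) : measurable A -> measurable B ->
  A `<=` B -> (perc p A <= perc p B)%E.
Proof. by move=> mA mB AB; apply: le_measure; rewrite ?inE. Qed.

Section Fixed.
Variable X : egraph.
Hypothesis X_struct : structured X.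

Lemma measurable_root_percolates : measurable [set w : conf | root_percolates X w].
Proof.
rewrite (_ : [set _ | _] = percolates X (Defs.root X).1 `|` percolates X (Defs.root X).2) //.
by apply: measurableU; exact: measurable_percolates.
Qed.

(** If the root percolates, then from the coarse edge containing it one reaches
    a terminal, which needs an open coarse edge. *)
Lemma root_percolates_le (q : R) m (e : edge (hG m)) k : 0 <= q <= 1 -> far 0 e ->
  spot e k X ->
  (perc q [set w : conf | root_percolates X w] <= (#|edge (hG m)|%:R * iter k f q)%:E)%E.
Proof.
move=> q01 fe [phi [d [rd de]]].
pose A (w : {ffun edge (hG (k + m)) -> bool}) := [exists c, (coarsen_iter w) c].
apply: (@le_trans _ _ (perc q [set w : conf | A (local_config phi w)])).
  apply: le_perc.
  - exact: measurable_root_percolates.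
  - exact: measurable_pull.
  move=> w; rewrite /= => rp.
  have {rp}[x xd /percolates_exit xst] : exists2 x, x = (val d).1 \/ x = (val d).2 &
      percolates X (phi x) w.
    case: rd rp => rE []; rewrite rE /= => h; first by exists (val d).1; [left|].
    - by exists (val d).2; [right|].
    - by exists (val d).2; [right|].
    - by exists (val d).1; [left|].
  have [t [tst xt]] : exists t, (t = src (hG m) \/ t = tgt (hG m)) /\
      connect (oadj (local_config phi w)) x (old_vertex k t).
    by case/orP: xst; [exists (src (hG m)); rewrite old_vertex_src; split; [left|]
      |exists (tgt (hG m)); rewrite old_vertex_tgt; split; [right|]].
  have := reach_ancestor xd xt; rewrite de; apply: contraLR => /existsPn closed.
  have ends y : near e 0 y -> connect (oadj (coarsen_iter (local_config phi w))) y t = false.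
    move=> /fe[ys yt]; apply/negP => /(oconnect_closed closed) E.
    by case: tst => tE; [move: ys|move: yt]; rewrite E tE eqxx.
  by rewrite !ends //; [exact: near_end2|exact: near_end1].
rewrite (perc_pull q01 (@edge_key_inj _ _ phi)) lee_fin /A.
rewrite (Pr_coarsen_iter k q (fun w : {ffun edge (hG m) -> bool} => [exists c, w c])).
exact: Pr_some_open (iter_crossing_01 G k q01).
Qed.

Lemma no_percolation (q : R) : 0 <= q <= 1 ->
  (fun k => iter k f q) @ \oo --> (0 : R) ->
  perc q [set w : conf | root_percolates X w] = 0%E.
Proof.
move=> q01 q0; have [m [e [fe spots]]] := X_struct 0.
apply/eqP; rewrite eq_le measure_ge0 andbT; apply/lee_addgt0Pr => e' e'0; rewrite add0e.
have n0 : 0 < #|edge (hG m)|%:R :> R.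
  by rewrite ltr0n; apply/card_gt0P; exists e.
have d0 : 0 < e' / #|edge (hG m)|%:R by rewrite divr_gt0.
move/cvgrPdist_le : q0 => /(_ _ d0)[K _ small].
have [k Kk sp] := spots K; apply: le_trans (root_percolates_le q01 fe sp) _.
rewrite lee_fin mulrC -ler_pdivlMr //; apply: le_trans (small k Kk).
by rewrite sub0r normrN ler_norm.
Qed.

Variable p : R.
Hypothesis p01 : 0 <= p <= 1.
Hypothesis p_to1 : (fun k => iter k f p) @ \oo --> (1 : R).

Lemma near_common u v : vert X u -> vert X v -> exists r, gball X r u /\ gball X r v.
Proof.
move=> /vert_gball[r ur] /vert_gball[s vs]; exists (maxn r s).
by split; [apply: gball_le ur; exact: leq_maxl|apply: gball_le vs; exact: leq_maxr].
Qed.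

(** Two infinite clusters both reach the terminals of every large block, so
    they are equal as soon as a large block is crossed. *)
Lemma disjoint_infinite0 u v : vert X u -> vert X v ->
  perc p (disjoint_infinite X u v) = 0%E.
Proof.
move=> uX vX; have [r [ur vr]] := near_common uX vX.
have [m [e [fe spots]]] := X_struct r.
apply/eqP; rewrite eq_le measure_ge0 andbT; apply/lee_addgt0Pr => e' e'0; rewrite add0e.
move/cvgrPdist_le : p_to1 => /(_ _ e'0)[K _ small].
have [k Kk [phi [d [rd de]]]] := spots K.
have fd : far r d by apply: far_ancestor; rewrite de.
apply: (@le_trans _ _ (perc p [set w : conf | ~~ crosses (local_config phi w)])).
  apply: le_perc.
  - exact: measurable_disjoint_infinite.
  - exact: (@measurable_pull _ _ (fun w => ~~ crosses w)).
  move=> w [uinf [vinf nuv]]; apply/negP => /connect_linked st.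
  have to_src n : gball X r n -> percolates X n w ->
      linked (open_adj X w) n (phi (src (hG (k + m)))).
    move=> /(gball_near rd fd)[x -> _] /percolates_exit /orP[] /connect_linked // h.
    apply: linked_trans h _; apply: linked_sym st; exact: open_adj_sym.
  apply: nuv; apply: linked_trans (to_src u ur uinf) _.
  apply: linked_sym (to_src v vr vinf); exact: open_adj_sym.
rewrite (perc_pull p01 (@edge_key_inj _ _ phi) (fun w => ~~ crosses w)).
rewrite PrC Pr_crosses_hier lee_fin; apply: le_trans (ler_norm _) _; apply: small.
by apply: leq_trans Kk _; exact: leq_addr.
Qed.

Hypothesis edge_disjoint : two_edge_disjoint_paths (src G) (tgt G).

Definition reaches m r : set conf :=
  \bigcup_(u in gball X m) \bigcup_(n in ~` gball X r)
    [set w : conf | linked (open_adj X w) u n].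

Lemma measurable_reaches m r : measurable (reaches m r).
Proof.
apply: bigcup_measurable => u _; apply: bigcup_measurable => n _.
exact: measurable_linked.
Qed.

(** If the clusters of all vertices of a ball are finite, they lie together in
    some larger ball. *)
Lemma reaches_infinite m : \bigcap_r reaches m r `<=` some_infinite X.
Proof.
move=> w h; apply: contrapT => none.
have fin u : gball X m u -> finite_set (Defs.cluster X w u).
  move=> um; apply: contrapT => uinf; apply: none; exists u => //.
  exact: gball_vert um.
pose S := \bigcup_(u in gball X m) Defs.cluster X w u.
have finS : finite_set S by apply: bigcup_finite => //; exact: gball_fin.
have SX n : S n -> exists r, gball X r n.
  move=> [u um un]; apply: vert_gball; apply: linked_vert un; exact: gball_vert um.
have [r Sr] : exists r, S `<=` gball X r.
  have /finite_seqP[s Es] := finS.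
  have : forall n, n \in s -> exists r, gball X r n by move=> n ns; apply: SX; rewrite Es.
  rewrite Es; elim: s {Es} => [|n s IH] hs; first by exists 0%N.
  have [|r rs] := IH; first by move=> x xs; apply: hs; rewrite inE xs orbT.
  have [r' r'n] := hs n (mem_head _ _).
  exists (maxn r r') => x /=; rewrite inE => /predU1P[->|xs].
    by apply: gball_le r'n; exact: leq_maxr.
  by apply: gball_le (rs x xs); exact: leq_maxl.
have [u um [n nr un]] := h r I; apply: nr; apply: Sr; by exists u.
Qed.

(** In a block of scale [K + i], an end of the ancestor of scale [K] of the root
    edge lies in a fixed ball, by [near_old_vertex]. By [Pr_ancestors] it is
    joined to a terminal of the block, which is as far away as one likes, with a
    probability close to 1 uniformly in [i]. *)
Lemma reaches_ge (e : R) : 0 < e -> exists m, forall r, ((1 - e)%:E <= perc p (reaches m r))%E.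
Proof.
move=> e0; have n0 : 0 < #|edge G|.+1%:R :> R by rewrite ltr0n.
have [K tail] := crossing_tail edge_disjoint p01 p_to1 (divr_gt0 e0 n0).
have [m old_near] := near_old_vertex G K; exists m => r.
have [M [c [fc spots]]] := X_struct r.
have [k Kk [phi [d [rd dc]]]] := spots K.
have fd : far r d by apply: far_ancestor; rewrite dc.
have {Kk spots dc} [i iE] : exists i, (k + M = K + i)%N.
  by exists (k + M - K)%N; rewrite subnKC // (leq_trans Kk) // leq_addr.
move: phi d rd fd; rewrite iE => phi d rd fd.
pose A (w : {ffun edge (hG (K + i)) -> bool}) :=
  connect (oadj (coarsen_iter w)) (val (ancestor d)).1 (src (hG i)).
apply: (@le_trans _ _ (perc p [set w : conf | A (local_config phi w)])); last first.
  apply: le_perc.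
  - exact: measurable_pull.
  - exact: measurable_reaches.
  move=> w /=; rewrite /A -connect_coarsen_iter old_vertex_src => /connect_linked lk.
  exists (phi (old_vertex K (val (ancestor d)).1)); first exact: near_gball (old_near _ _).
  exists (phi (src (hG (K + i)))) => //; exact: src_notin_gball rd fd.
rewrite (perc_pull p01 (@edge_key_inj _ _ phi)) lee_fin /A.
rewrite (Pr_coarsen_iter K p
  (fun w : {ffun edge (hG i) -> bool} => connect (oadj w) (val (ancestor d)).1 (src (hG i)))).
rewrite lerBlDr -lerBlDl -PrC.
apply: le_trans (Pr_ancestors (ancestor d) (iter_crossing_01 G K p01)) _.
apply: (@le_trans _ _ (#|edge G|.+1%:R * (e / #|edge G|.+1%:R))); last first.
  by rewrite mulrC divfK ?gt_eqF.
have sum0 : 0 <= \sum_(j < i) (1 - iter j f (iter K f p)).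
  apply: sumr_ge0 => j _; rewrite subr_ge0 -iterD.
  by have /andP[] := iter_crossing_01 G (j + K) p01.
apply: ler_pM => //; first by rewrite ler_nat.
by under eq_bigr do rewrite -iterD; exact: tail.
Qed.

Lemma some_infinite1 : perc p (some_infinite X) = 1%E.
Proof.
have mI := measurable_some_infinite X.
apply/eqP; rewrite eq_le probability_le1 //=.
apply/lee_addgt0Pr => e e0.
have [m lower] := reaches_ge e0.
have mcap : measurable (\bigcap_r reaches m r).
  by apply: bigcap_measurableType => r _; exact: measurable_reaches.
rewrite -leeBlDr // -EFinB; apply: (@le_trans _ _ (perc p (\bigcap_r reaches m r))); last first.
  by apply: le_perc => //; exact: reaches_infinite.
have cvg : (perc p \o reaches m) @ \oo --> perc p (\bigcap_r reaches m r).
  apply: nonincreasing_cvg_mu => //.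
  - by apply: le_lt_trans (probability_le1 _ (measurable_reaches m 0)) _; rewrite ltry.
  - exact: measurable_reaches.
  move=> r s rs; apply/subsetPset => w [u um [n ns un]]; exists u => //; exists n => //.
  by move=> nr; apply: ns; exact: gball_le nr.
by apply: cvge_ge cvg; apply: nearW => r; exact: lower.
Qed.

Lemma unique_infinite_cluster :
  perc p [set w | num_infinite_clusters X w R = 1%E] = 1%E.
Proof.
rewrite num_infinite_clusters1; set D := \bigcup_(u in _) _.
have mD : measurable D.
  apply: bigcup_measurable => u _; apply: bigcup_measurable => v _.
  exact: measurable_disjoint_infinite.
have D0 : (perc p).-negligible D.
  rewrite /D bigcup_mkcond; apply: negligible_bigcup => u.
  case: ifPn => [/set_mem uX|_]; last exact: negligible_set0.
  rewrite bigcup_mkcond; apply: negligible_bigcup => v.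
  case: ifPn => [/set_mem vX|_]; last exact: negligible_set0.
  exists (disjoint_infinite X u v); split => //.
    exact: measurable_disjoint_infinite.
  exact: disjoint_infinite0.
have pD : perc p D = 0%E by exact: measure_negligible.
have mI := measurable_some_infinite X.
have I1 := some_infinite1.
have ID0 : perc p (some_infinite X `&` D) = 0%E.
  apply/eqP; rewrite eq_le measure_ge0 andbT -pD.
  by apply: le_perc; [exact: measurableI|exact: mD|exact: subIsetr].
have fin : (perc p (some_infinite X) < +oo)%E by rewrite I1 ltry.
by apply: etrans (measureD mI mD fin) _; rewrite -[X in _ = X]sube0; congr (_ - _)%E.
Qed.

End Fixed.

Hypothesis edge_disjoint : two_edge_disjoint_paths (src G) (tgt G).

(** By [no_percolation], a parameter whose iterates tend to 0 is at most
    [pcrit x]. Applied to 0 this shows that [pcrit x] is nonnegative; applied to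
    a point between [pcrit x] and [p] it leaves only the second case of
    [iter_crossing_dichotomy]. *)
Lemma above_pcrit (x : egspace R) (p : R) : structured (egrepr x) ->
  pcrit x < p -> p <= 1 -> 0 <= p /\ (fun k => iter k f p) @ \oo --> (1 : R).
Proof.
move=> X_struct xp p1.
pose S : set R := [set q | 0 <= q <= 1 /\ theta x q = 0%E].
have S0 : S 0.
  have i01 : 0 <= (0 : R) <= 1 by rewrite lexx ler01.
  split=> //; apply: no_percolation => //.
  have -> : (fun k => iter k f 0) = fun=> 0.
    by apply/funext => k; elim: k => //= k ->; exact: crossing0.
  exact: cvg_cst.
have Sub : has_ubound S by exists 1 => q [/andP[]].
have pc0 : 0 <= pcrit x by apply: ub_le_sup.
have p0 : 0 < p by exact: le_lt_trans xp.
split; first exact: ltW.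
have [xq qp] := midf_lt xp; set q := (_ + _) / _ in xq qp.
have q0 : 0 < q by exact: le_lt_trans xq.
have [q_to0|//] := iter_crossing_dichotomy edge_disjoint q0 qp p1.
have q01 : 0 <= q <= 1 by rewrite !ltW // (lt_le_trans qp).
have : q <= pcrit x by apply: ub_le_sup => //; split=> //; exact: no_percolation.
by rewrite leNgt xq.
Qed.

Lemma structured_unique (x : egspace R) (p : R) : structured (egrepr x) ->
  pcrit x < p -> p <= 1 ->
  perc p [set w | num_infinite_clusters (egrepr x) w R = 1%E] = 1%E.
Proof.
move=> X_struct xp p1; have [p0 p_to1] := above_pcrit X_struct xp p1.
by apply: unique_infinite_cluster => //; rewrite p0.
Qed.

End Structured.

(** * Counting the edges around which no block of a given shape is found *)

Section Counting.
Variable G : ograph.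
Local Notation hG := (hier G).

Lemma card_edge_replace (H : ograph) :
  #|edge (replace H G)| = (#|edge H| * #|edge G|)%N.
Proof.
rewrite -card_prod; apply: (bij_eq_card (f := fun d => (parent d, digit d))).
exists (fun ef => child ef.1 ef.2) => [d|[e f]] /=; first exact: split_edgeK.
by rewrite parent_child digit_child.
Qed.

Lemma card_edge_hier n : #|edge (hG n)| = (#|edge G| ^ n)%N.
Proof.
elim: n => [|n IH]; last by rewrite card_edge_replace IH expnSr.
by apply: (fintype.eq_card1 (x := the_edge)) => e; rewrite (the_edgeE e) !inE eqxx.
Qed.

Lemma ancestor_position_inj m i (c c' : edge (hG (m + i))) :
  ancestor c = ancestor c' -> position c = position c' -> c = c'.
Proof. by move=> E E'; rewrite -(block_at_position c) E E' block_at_position. Qed.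

Lemma card_ancestor_position m i (A : {set edge (hG (m + i))}) (B : {set edge (hG i)})
    (C : {set edge (hG m)}) :
  (forall c, c \in A -> ancestor c \in B /\ position c \in C) -> (#|A| <= #|B| * #|C|)%N.
Proof.
move=> ABC; rewrite -cardsX.
have inj : {in A &, injective (fun c => (ancestor c, position c))}.
  by move=> c c' _ _ [] /ancestor_position_inj; apply.
rewrite -(card_in_imset inj); apply: subset_leq_card; apply/fintype.subsetP => _ /imsetP[c cA ->].
by have [h1 h2] := ABC c cA; rewrite finset.in_setX /= h1.
Qed.

Variables (m : nat) (e : edge (hG m)).

(** The counterpart of [spot] in the finite graphs, stable under replacement. *)
Definition ospot k (H : ograph) (c : edge H) : Prop :=
  exists (phi : oblock (hG (k + m)) H) (d : edge (hG (k + m))),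
    ancestor d = e /\ c = emap phi d.

Lemma ospot_block_at i (c : edge (hG i)) : ospot 0 (emap (block_at m c) e).
Proof. by exists (block_at m c), e. Qed.

Lemma ospot_child k (H : ograph) (c : edge H) (f : edge G) : ospot k c -> ospot k.+1 (child c f).
Proof.
move=> [phi [d [de ->]]].
exists (lift_block G phi), (child d f : edge (replace (hG (k + m)) G)).
by rewrite emap_lift /= parent_child.
Qed.

Lemma ospot_ancestor K n k (c : edge (hG (K + n))) : ospot k (ancestor c) -> ospot (K + k) c.
Proof.
elim: K c => //= K IH c /IH h.
rewrite -(split_edgeK (c : edge (replace (hG (K + n)) G))).
exact: ospot_child.
Qed.

(** The number [J * m + i] of [levelE], written so that one step unfolds to
    [m + level J i]. *)
Fixpoint level J i : nat := if J is J'.+1 then m + level J' i else i.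

Lemma levelE J i : level J i = (J * m + i)%N.
Proof. by elim: J => //= J ->; rewrite mulSn addnA. Qed.

Definition no_spot J i : {set edge (hG (level J i))} :=
  [set c | `[< forall j, (j < J)%N -> ~ ospot (j * m) c >]].

(** The positions of an edge at successive scales [m] apart range independently
    over [#|edge G| ^ m] values, and one value is excluded at each scale. *)
Lemma card_no_spot J i :
  (#|no_spot J i| <= #|edge G| ^ i * (#|edge G| ^ m - 1) ^ J)%N.
Proof.
elim: J => [|J IH]; first by rewrite muln1 -card_edge_hier max_card.
rewrite expnSr mulnA; apply: leq_trans (leq_mul IH (leqnn _)).
have <- : #|[set~ e]%SET| = (#|edge G| ^ m - 1)%N by rewrite cardsC1 card_edge_hier subn1.
apply: card_ancestor_position => c; rewrite !finset.in_set => /asboolP none; split.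
  apply/asboolP => j jJ /(@ospot_ancestor m) h; exact: (none j.+1).
rewrite finset.in_set1; apply/eqP => ce; apply: (none 0%N) => //.
by rewrite -(block_at_position c) ce; exact: ospot_block_at.
Qed.

Lemma card_no_spot_window K J i :
  (#|[set c : edge (hG (K + level J i)) |
      `[< forall j, (j < J)%N -> ~ ospot (K + j * m) c >]]%SET| <=
   #|edge G| ^ K * (#|edge G| ^ i * (#|edge G| ^ m - 1) ^ J))%N.
Proof.
apply: (@leq_trans (#|no_spot J i| * #|[set: edge (hG K)]%SET|)).
  apply: card_ancestor_position => c; rewrite !finset.in_set => /asboolP none; split=> //.
  by apply/asboolP => j jJ h; apply: (none j jJ); exact: ospot_ancestor.
by rewrite cardsT card_edge_hier mulnC leq_mul2l card_no_spot orbT.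
Qed.

End Counting.

Section RootedBlocks.
Variables (H : ograph) (c : edge H).

Lemma rooted_adj (u v : H) : adj (rooted c) (enum_rank u) (enum_rank v) = uadj u v.
Proof.
apply/existsP/idP => [[u' /existsP[v' /and3P[/eqP E1 /eqP E2 uv]]]|uv].
  by rewrite (enum_rank_inj (val_inj E1)) (enum_rank_inj (val_inj E2)).
by exists u; apply/existsP; exists v; rewrite !eqxx.
Qed.

Lemma rooted_adjP (u : H) n : adj (rooted c) (enum_rank u) n ->
  exists2 v, n = enum_rank v & uadj u v.
Proof.
move=> /existsP[u' /existsP[v' /and3P[/eqP E1 /eqP E2 uv]]]; exists v' => //.
by rewrite (enum_rank_inj (val_inj E1)).
Qed.

Variables (H' : ograph) (phi : oblock H' H).

Let num (u : H') : nat := enum_rank (phi u).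

Let num_inj : injective num.
Proof. by move=> u v /val_inj/enum_rank_inj/(@oblock_inj _ _ phi). Qed.

Let num_edge u v : oedge H' u v -> adj (rooted c) (num u) (num v).
Proof. by move=> uv; rewrite rooted_adj /uadj (oblock_edge phi uv). Qed.

Let num_inner u n : u != src H' -> u != tgt H' -> adj (rooted c) (num u) n ->
  exists2 v, n = num v & uadj u v.
Proof.
move=> us ut /rooted_adjP[x -> /(oblock_inner us ut)[v -> uv]].
by exists v.
Qed.

Definition rooted_block : eblock (rooted c) H' := EBlock num_inj num_edge num_inner.

End RootedBlocks.

Lemma ospot_spot (G : ograph) m (e : edge (hier G m)) k (H : ograph) (c : edge H) :
  ospot e k c -> spot e k (rooted c).
Proof.
move=> [phi [d [de ->]]].
by exists (rooted_block (emap phi d) phi), d; split=> //; left.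
Qed.

Section LocalBlocks.
Variables (X Y : egraph) (H : ograph) (phi : eblock X H) (d : edge H) (D : nat) (f : nat -> nat).
Hypothesis phi_root : at_root phi d.
Hypothesis near_d : forall u, near d D u.
Hypothesis f_iso : rooted_iso X (gball X D.+1) Y (gball Y D.+1) f.

Let inball u : gball X D.+1 (phi u).
Proof. by apply: (gball_le (leqnSn D)); exact: near_gball phi_root (near_d u). Qed.

Let phi' (u : H) : nat := f (phi u).

Let phi'_inj : injective phi'.
Proof.
have [fb _ _] := f_iso; move=> u v /(set_bij_inj fb); rewrite !inE => h.
by apply: (@eblock_inj _ _ phi); apply: h; exact: inball.
Qed.

Let phi'_edge u v : oedge H u v -> adj Y (phi' u) (phi' v).
Proof.
have [_ fadj _] := f_iso; move=> uv.
by rewrite fadj ?(eblock_edge phi uv) //; exact: inball.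
Qed.

Let phi'_inner u n : u != src H -> u != tgt H -> adj Y (phi' u) n ->
  exists2 v, n = phi' v & uadj u v.
Proof.
have [[_ _ fsurj] fadj _] := f_iso; move=> us ut un.
have nball : gball Y D.+1 n.
  apply: gball_adj un; apply: (iso_gball (leqnSn D) _ f_iso) => //.
  exact: near_gball phi_root (near_d u).
have [x xball xn] := fsurj n nball; move: un; rewrite -xn (fadj _ _ (inball u) xball).
by move=> /(eblock_inner us ut)[v -> uv]; exists v.
Qed.

Definition transport_block : eblock Y H := EBlock phi'_inj phi'_edge phi'_inner.

Lemma transport_root : at_root transport_block d.
Proof.
have [_ _ froot] := f_iso; rewrite /at_root.
by case: froot => <-; case: phi_root => -> /=; [left|right|right|left].
Qed.

End LocalBlocks.

Lemma ograph_diam (H : ograph) (d : edge H) : exists D, forall u, near d D u.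
Proof.
exists (\max_(u : H) gdist (@uadj H) (val d).1 u) => u.
exists (gdist (@uadj H) (val d).1 u); first exact: (leq_bigmax u).
left; apply: gdistP; have /connectP[s ps E] := ograph_conn (val d).1 u.
by exists s.
Qed.

(** A block has finite diameter [D], so it is carried along by an isomorphism of
    balls of radius [D.+1]; the extra step shows all the neighbours of the
    vertices of the block. *)
Lemma spot_local (G : ograph) m (e : edge (hier G m)) k :
  exists r, forall X Y, ball_iso r X Y -> spot e k X -> spot e k Y.
Proof.
have [D Dnear] : exists D, forall d u, @near (hier G (k + m)) d D u.
  pose D d := projT1 (cid (@ograph_diam (hier G (k + m)) d)).
  exists (\max_d D d) => d u.
  apply: (spread_le (near_spread d)) (projT2 (cid (ograph_diam d)) u).
  exact: (leq_bigmax d).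
exists D.+1 => X Y [f f_iso] [phi [d [rd de]]].
by exists (transport_block rd (Dnear d) f_iso), d; split=> //; exact: transport_root.
Qed.

(** * Almost every limit graph contains large blocks around its root *)

Section Limit.
Variables (R : realType) (G : ograph) (mu : probability (egspace_borel R) R).
Hypothesis limit : is_bs_limit G mu.
Local Notation hG := (hier G).

Section Local.
Variables (W : set (egspace R)) (r : nat).
Hypothesis W_local : forall x y : egspace R,
  ball_iso r (egrepr x) (egrepr y) -> W x -> W y.

Lemma local_nbhs (x : egspace R) :
  \forall y \near x, ball_iso r (egrepr x) (egrepr y).
Proof.
have r0 : 0 < r.+1%:R^-1 :> R by rewrite invr_gt0.
apply/nbhs_ballP; exists r.+1%:R^-1 => //= y.
rewrite ballEmdist => /(@egdist_lt R x y _)[s sxy].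
rewrite ltf_pV2 ?posrE // ltr_nat => rs; apply: ball_iso_le sxy; exact: ltnW.
Qed.

Lemma local_open : open W.
Proof.
rewrite openE => x Wx; rewrite /interior.
by apply: filterS (local_nbhs x) => y xy; exact: W_local Wx.
Qed.

Lemma local_measurable : measurable (W : set (egspace_borel R)).
Proof. by apply: sub_sigma_algebra; exact: local_open. Qed.

(** A property decided by a ball of fixed radius is open and closed, so its
    indicator is a test function for convergence in distribution. *)
Lemma local_continuous : continuous (\1_W : egspace R -> R).
Proof.
move=> x; apply: (@cvg_near_cst _ _ _ _ (nbhs x) (nbhs_filter x)).
have := local_nbhs x; apply: filterS => y xy.
rewrite !indicE; congr (_%:R); congr nat_of_bool; apply/idP/idP => /set_mem h;
  apply/mem_set; apply: W_local h => //; exact: ball_iso_sym.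
Qed.

Lemma local_limit : (fun k => (\sum_(e : edge (hG k)) \1_W (egclass R (rooted e))) /
  #|edge (hG k)|%:R) @ \oo --> fine (mu W).
Proof.
have := limit local_continuous.
have -> : (\int[mu]_x \1_W x)%R = fine (mu W).
  rewrite /Rintegral (integral_indic _ measurableT) ?setIT //.
  exact: local_measurable.
apply; exists 1 => x; rewrite indicE; case: (x \in W); by rewrite ?normr1 ?normr0.
Qed.

Lemma local_ge (a : R) (N : nat) :
  (forall n, (N <= n)%N -> exists bad : {set edge (hG n)},
    (forall c, c \notin bad -> W (egclass R (rooted c))) /\
    #|bad|%:R <= a * #|edge (hG n)|%:R) ->
  ((1 - a)%:E <= mu W)%E.
Proof.
move=> few; have mW := local_measurable.
rewrite -(@fineK _ (mu W)) ?fin_num_measure // lee_fin.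
apply: (cvgr_to_ge local_limit).
exists N => // n /= /few[bad [good few_bad]].
have n0 : 0 < #|edge (hG n)|%:R :> R.
  rewrite ltr0n card_edge_hier expn_gt0; apply/orP; left; apply/card_gt0P.
  have [y sy] : exists y, uadj (src G) y.
    have /connectP[[|y s] /= ps lt_] := ograph_conn (src G) (tgt G).
      by have := src_neq_tgt G; rewrite lt_ eqxx.
    by exists y; case/andP: ps.
  by have [f _] := uadj_joins sy; exists f.
rewrite ler_pdivlMr // mulrBl mul1r lerBlDr.
apply: (@le_trans _ _ (\sum_(c : edge (hG n)) \1_W (egclass R (rooted c)) + #|bad|%:R)).
  rewrite -[#|edge (hG n)|%:R]sumr_const -[#|bad|%:R]sumr_const.
  rewrite [X in _ + X]big_mkcond -big_split /=; apply: ler_sum => c _.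
  rewrite indicE; case: (boolP (c \in bad)) => [_|/good Wc]; first by rewrite lerDr.
  by rewrite mem_set // addr0.
by rewrite lerD2l.
Qed.

End Local.

Variables (m : nat) (e : edge (hG m)).

(** Only a bounded range of scales is decided by a ball of fixed radius. *)
Definition window K L : set (egspace R) :=
  [set x | exists2 k, (K <= k < L)%N & spot e k (egrepr x)].

Lemma window_local K L : exists r, forall x y : egspace R,
  ball_iso r (egrepr x) (egrepr y) -> window K L x -> window K L y.
Proof.
elim: L => [|L [r IH]].
  by exists 0%N => x y _ [k]; rewrite ltn0 andbF.
have [s sL] := spot_local e L; exists (maxn r s) => x y xy [k /andP[Kk]].
rewrite ltnS leq_eqVlt => /predU1P[kL|kL] sp.
  rewrite kL in Kk sp; exists L; first by rewrite Kk /=.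
  by apply: sL sp; apply: ball_iso_le xy; exact: leq_maxr.
have [|k' /andP[Kk' k'L] sp'] := IH x y (ball_iso_le (leq_maxl r s) xy).
  by exists k => //; rewrite Kk.
by exists k' => //; rewrite Kk' ltnS ltnW.
Qed.

Lemma window_ge K J :
  ((1 - ((#|edge G| ^ m - 1)%:R / (#|edge G| ^ m)%:R) ^+ J)%:E <=
    mu (window K (K + J * m).+1))%E.
Proof.
have [r W_local] := window_local K (K + J * m).+1.
apply: (local_ge W_local (N := (K + J * m)%N)) => n Kn.
have [i ->] : exists i, n = (K + level m J i)%N.
  by exists (n - (K + J * m))%N; rewrite levelE addnA subnKC.
exists [set c | `[< forall j, (j < J)%N -> ~ ospot e (K + j * m) c >]]%SET; split.
  move=> c; rewrite finset.in_set => /asboolPn/existsNP[j /not_implyP[jJ /contrapT sp]].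
  have c_iso : egraph_iso (rooted c) (egrepr (egclass R (rooted c))).
    by apply/(@egclass_eq R); rewrite egreprK.
  have [s sp_local] := spot_local e (K + j * m).
  exists (K + j * m)%N.
    by rewrite leq_addr ltnS leq_add2l leq_mul2r (ltnW jJ) orbT.
  by apply: sp_local (ospot_spot sp); exact: egraph_iso_ball.
apply: le_trans (_ : (#|edge G| ^ K * (#|edge G| ^ i * (#|edge G| ^ m - 1) ^ J))%:R <= _).
  by rewrite ler_nat; exact: card_no_spot_window.
have Em0 : (#|edge G| ^ m)%:R != 0 :> R.
  by rewrite -card_edge_hier pnatr_eq0 -lt0n; apply/card_gt0P; exists e.
have -> : #|edge (hG (K + level m J i))| =
    (#|edge G| ^ K * (#|edge G| ^ i * (#|edge G| ^ m) ^ J))%N.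
  by rewrite card_edge_hier levelE !expnD mulnC [(J * m)%N]mulnC expnM mulnC
    [(_ ^ i * _)%N]mulnC.
rewrite !natrM expr_div_n -!natrX [leRHS]mulrCA ler_wpM2l ?ler0n //.
by rewrite [leRHS]mulrCA divfK // natrX expf_neq0.
Qed.

(** The lower bound of [window_ge] tends to 1 as the window grows. *)
Lemma ae_spot K : {ae mu, forall x : egspace R,
  exists2 k, (K <= k)%N & spot e k (egrepr x)}.
Proof.
pose W := \bigcup_L window K L.
have mwin L : measurable (window K L : set (egspace_borel R)).
  by have [r W_local] := window_local K L; exact: local_measurable W_local.
have mW : measurable (W : set (egspace_borel R)) by apply: bigcup_measurable.
set z : R := (#|edge G| ^ m - 1)%:R / (#|edge G| ^ m)%:R.
have Em0 : 0 < (#|edge G| ^ m)%:R :> R.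
  by rewrite -card_edge_hier ltr0n; apply/card_gt0P; exists e.
have z0 : 0 <= z by rewrite divr_ge0.
have z1 : z < 1.
  rewrite ltr_pdivrMr // mul1r ltr_nat.
  by rewrite ltn_subrL /= -(@ltr0n R).
have W1 : mu W = 1%E.
  apply/eqP; rewrite eq_le probability_le1 //=; apply/lee_addgt0Pr => d d0.
  have /cvgrPdist_le/(_ d d0)[J _ /(_ J (leqnn J)) /= zJ] :
    (fun J => z ^+ J) @ \oo --> (0 : R) by apply: cvg_expr; rewrite ger0_norm.
  rewrite -leeBlDr // -EFinB; apply: (@le_trans _ _ (1 - z ^+ J)%:E).
    rewrite lee_fin lerD2l lerN2; apply: le_trans zJ.
    by rewrite sub0r normrN ler_norm.
  apply: le_trans (window_ge K J) _; apply: le_measure; rewrite ?inE //.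
  exact: bigcup_sup.
exists (~` W); split.
- exact: measurableC.
- by apply: etrans (probability_setC _ mW) _; rewrite W1 subee.
- move=> x /= nsp [L _ [k /andP[Kk _] sp]]; apply: nsp; by exists k.
Qed.

End Limit.

Lemma ae_structured (R : realType) (G : ograph) (mu : probability (egspace_borel R) R) :
  (1 < gdist (@uadj G) (src G) (tgt G))%N -> is_bs_limit G mu ->
  {ae mu, forall x : egspace R, structured G (egrepr x)}.
Proof.
move=> dst limit; apply: ae_foralln => r; have [m [e fe]] := far_edge dst r.
have : {ae mu, forall x : egspace R, forall K,
    exists2 k, (K <= k)%N & spot e k (egrepr x)}.
  by apply: ae_foralln => K; exact: ae_spot.
by have F := ae_filter_ringOfSetsType mu; apply: filterS => x h; exists m, e.
Qed.

Theorem theorem6p3 (R : realType) (G1 : ograph)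
    (mu : probability (egspace_borel R) R) (p_c : R) :
  (1 < gdist (@uadj G1) (src G1) (tgt G1))%N ->
  two_edge_disjoint_paths (src G1) (tgt G1) ->
  is_bs_limit G1 mu ->
  {ae mu, forall x : egspace R, pcrit x = p_c} ->
  forall p : R, p_c < p <= 1 ->
  {ae mu, forall x : egspace R,
    perc p [set w | num_infinite_clusters (egrepr x) w R = 1%E] = 1%E}.
Proof.
move=> dst edge_disjoint limit pc p /andP[pcp p1].
have F := ae_filter_ringOfSetsType mu.
apply: filterS2 (ae_structured dst limit) pc => x X_struct xpc.
apply: (structured_unique edge_disjoint X_struct) => //.
by rewrite [pcrit x]xpc.
Qed.
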